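(* Let $N\ge 2$ and let $B$ be the open unit ball of $\mathbb{R}^N$. Let $a\in C^1([0,1],\mathbb{R})$ be nondecreasing with $a_0:=a(0)>0$, and suppose that $x\mapsto a(|x|)$ is nonconstant on $B$. Let $b\in C([0,1],\mathbb{R})$ be nonpositive, with $r\mapsto b(r)r$ differentiable in $(0,1)$ and $\frac{d}{dr}(b(r)r)>-1-\frac{N-1}{r^2}$ for all $r\in(0,1)$. Let $f\in C^1([0,+\infty),\mathbb{R})$ be nondecreasing with $f(0)=0$, $f'(0)=\lim_{s\to0^+}\frac{f(s)}{s}=0$ and $\liminf_{s\to+\infty}\frac{f(s)}{s}>\frac1{a_0}$. Then there exists at least one nonconstant radial solution $u$, nondecreasing as a function of $|x|$, of the problem $$-\Delta u+b(|x|)\,x\cdot\nabla u+u=a(|x|)f(u)\ \text{ in } B,\qquad u>0\ \text{ in } B,\qquad \partial_\nu u=0\ \text{ on }\partial B.$$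
   Context: $\nu$ denotes the outer unit normal on $\partial B$. A solution is a function $u\in H^2(B)$ satisfying the equation almost everywhere in $B$ and the Neumann boundary condition in the sense of traces. *)

(* Defs.v *)
From HB Require Import structures.
From mathcomp Require Import all_boot all_order all_algebra.
From mathcomp Require Import all_classical all_reals all_analysis.
From mathcomp Require Import measurable_realfun.
Set Implicit Arguments.
Unset Strict Implicit.
Unset Printing Implicit Defensive.
Import Order.TTheory GRing.Theory Num.Theory.
Import numFieldNormedType.Exports.
Local Open Scope classical_set_scope.
Local Open Scope ring_scope.

(* The sigma-algebra on row vectors is generated by the coordinates; for
   vectors over a realType it is the Borel sigma-algebra. *)
Definition measure_rV_display : measure_display -> measure_display.
Proof. exact. Qed.

Section measurable_rV.
Context {d} {T : measurableType d}.
Variable n : nat.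

Let coors : 'I_n -> 'rV[T]_n -> T := fun i x => x ord0 i.

Let rV_set0 : g_sigma_preimage coors set0.
Proof. exact: sigma_algebra0. Qed.

Let rV_setC A : g_sigma_preimage coors A -> g_sigma_preimage coors (~` A).
Proof. exact: sigma_algebraC. Qed.

Let rV_bigcup (F : _^nat) : (forall i, g_sigma_preimage coors (F i)) ->
  g_sigma_preimage coors (\bigcup_i (F i)).
Proof. exact: sigma_algebra_bigcup. Qed.

HB.instance Definition _ := @isMeasurable.Build (measure_rV_display d)
  'rV[T]_n (g_sigma_preimage coors) rV_set0 rV_setC rV_bigcup.

Lemma measurable_coord (i : 'I_n) :
  measurable_fun [set: 'rV[T]_n] (fun v : 'rV[T]_n => v ord0 i).
Proof.
move=> _ Y mY; rewrite setTI; apply: sub_sigma_algebra => /=.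
rewrite -bigcup_seq/=; exists i => /=; first by rewrite mem_index_enum.
by exists Y => //; rewrite setTI.
Qed.

Lemma measurable_fun_rV d' (S : measurableType d') (f : S -> 'rV[T]_n) :
  (forall i, measurable_fun [set: S] (fun x => f x ord0 i)) ->
  measurable_fun [set: S] f.
Proof.
move=> mf _ Y mY.
have sub : g_sigma_preimage coors `<=` image_set_system [set: S] f measurable.
  apply: smallest_sub.
    by apply: sigma_algebra_image; exact: sigma_algebra_measurable.
  move=> A; rewrite -bigcup_seq => -[i _ [B mB <-]].
  by rewrite /image_set_system /= setTI; exact: (mf i).
exact: sub mY.
Qed.

End measurable_rV.

Section lebesgue_rV.
Context {R : realType}.

Definition rV_cons n (p : measurableTypeR R * 'rV[R]_n) : 'rV[R]_n.+1 :=
  \row_i oapp (p.2 ord0) p.1 (unlift ord0 i).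

Definition rV_uncons n (v : 'rV[R]_n.+1) : measurableTypeR R * 'rV[R]_n :=
  (v ord0 ord0, \row_i v ord0 (lift ord0 i)).

Lemma rV_consK n : cancel (@rV_cons n) (@rV_uncons n).
Proof.
move=> [x v]; rewrite /rV_uncons /rV_cons; congr pair.
  by rewrite mxE unlift_none.
by apply/rowP => i; rewrite !mxE liftK.
Qed.

Lemma measurable_rV_cons n : measurable_fun [set: _] (@rV_cons n).
Proof.
apply: measurable_fun_rV => i; rewrite /rV_cons.
under eq_fun do rewrite mxE.
case: unliftP => [j _|_] /=; last exact: measurable_fst.
exact: (measurableT_comp (measurable_coord j) measurable_snd).
Qed.

HB.instance Definition _ n := isMeasurableFun.Build _ _ _ _ (@rV_cons n)
  (@measurable_rV_cons n).

Lemma measurable_rV_uncons n : measurable_fun [set: _] (@rV_uncons n).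
Proof.
apply/measurable_fun_pairP; split => /=; first exact: measurable_coord.
apply: measurable_fun_rV => i /=; under eq_fun do rewrite mxE.
exact: measurable_coord.
Qed.

Section step.
Variables (n : nat) (m : {sigma_finite_measure set 'rV[R]_n -> \bar R}).
Local Open Scope ereal_scope.

Definition lebesgue_rV_step : set 'rV[R]_n.+1 -> \bar R :=
  pushforward (lebesgue_measure \x m) (@rV_cons n).


Let lebesgue_rV_step0 : lebesgue_rV_step set0 = 0.
Proof. exact: measure0. Qed.

Let lebesgue_rV_step_ge0 A : 0 <= lebesgue_rV_step A.
Proof. exact: measure_ge0. Qed.

Let lebesgue_rV_step_sigma_additive : semi_sigma_additive lebesgue_rV_step.
Proof. exact: measure_semi_sigma_additive. Qed.

HB.instance Definition _ := isMeasure.Build _ _ _ lebesgue_rV_step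
  lebesgue_rV_step0 lebesgue_rV_step_ge0 lebesgue_rV_step_sigma_additive.

Let lebesgue_rV_step_sigma_finite : sigma_finite setT lebesgue_rV_step.
Proof.
have /sigma_finiteP[F [TF ndF Foo]] := sigma_finiteT (@lebesgue_measure R).
have /sigma_finiteP[G [TG ndG Goo]] := sigma_finiteT m.
exists (fun k => @rV_uncons n @^-1` (F k `*` G k)).
  rewrite -preimage_bigcup (_ : \bigcup_i _ = setT) ?preimage_setT//.
  rewrite -subTset -setXTT TF TG => -[x y] [/= [k _ Fkx] [l _ Gly]].
  exists (maxn k l) => //; split.
    by move: x Fkx; exact/subsetPset/ndF/leq_maxl.
  by move: y Gly; exact/subsetPset/ndG/leq_maxr.
move=> k; have [mF Fk] := Foo k; have [mG Gk] := Goo k; split.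
  rewrite -[X in measurable X]setTI; apply: measurable_rV_uncons => //.
  exact: measurableX.
rewrite /lebesgue_rV_step /pushforward -comp_preimage.
rewrite (_ : _ \o _ = id); last by apply/funext => p; exact: rV_consK.
by rewrite preimage_id product_measure1E// lte_mul_pinfty// ge0_fin_numE.
Qed.

HB.instance Definition _ := Measure_isSigmaFinite.Build _ _ _
  lebesgue_rV_step lebesgue_rV_step_sigma_finite.

End step.

(* Lebesgue measure on R^n (on Borel sets), as an iterated product *)
Fixpoint lebesgue_rV n : {sigma_finite_measure set 'rV[R]_n -> \bar R} :=
  if n is n'.+1 return {sigma_finite_measure set 'rV[R]_n -> \bar R}
  then lebesgue_rV_step (lebesgue_rV n') else dirac (const_mx 0 : 'rV[R]_0).

End lebesgue_rV.

Section euclidean_ball.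
Context {R : realType} {n : nat}.
Local Notation V := 'rV[R]_n.

(* the library norm on row vectors is the sup norm *)
Definition enorm (x : V) : R := Num.sqrt (\sum_i x ord0 i ^+ 2).

Definition unit_ball : set V := [set x | enorm x < 1].
Definition closed_unit_ball : set V := [set x | enorm x <= 1].
Definition unit_sphere : set V := [set x | enorm x = 1].

Lemma measurable_enorm : measurable_fun [set: V] enorm.
Proof.
have msum : measurable_fun [set: V] (fun x : V => \sum_i x ord0 i ^+ 2 : R).
  apply: measurable_sum => i; apply: measurable_funX; exact: measurable_coord.
exact: (measurableT_comp (continuous_measurable_fun (@sqrt_continuous R)) msum).
Qed.

Lemma measurable_unit_ball : measurable unit_ball.
Proof.
rewrite -[X in measurable X]setTI.
exact: (measurable_enorm measurableT (measurable_itv `]-oo, 1[)).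
Qed.

Definition radial_proj (x : V) : V := (enorm x)^-1 *: x.

Lemma measurable_inv : measurable_fun [set: R] (@GRing.inv R).
Proof.
rewrite -(setvU [set 0]); apply/measurable_funU => //; first exact: measurableC.
split; last exact: measurable_fun_set1.
apply: open_continuous_measurable_fun; first exact/closed_openC/closed_eq.
by move=> x; rewrite inE /= => /eqP x0; exact: inv_continuous.
Qed.

Lemma measurable_radial_proj : measurable_fun [set: V] radial_proj.
Proof.
apply: measurable_fun_rV => i; rewrite /radial_proj.
under eq_fun do rewrite mxE.
apply: measurable_funM; last exact: measurable_coord.
exact: (measurableT_comp (measurable_inv) measurable_enorm).
Qed.

HB.instance Definition _ :=
  isMeasurableFun.Build _ _ _ _ radial_proj measurable_radial_proj.

(* the volume of the cone {x | 0 < |x| < 1, x / |x| \in A} *)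
Definition cone_measure : set V -> \bar R :=
  pushforward (mrestr (lebesgue_rV n) measurable_unit_ball) radial_proj.

Let cone_measure0 : cone_measure set0 = 0%E.
Proof. exact: measure0. Qed.

Let cone_measure_ge0 A : (0 <= cone_measure A)%E.
Proof. exact: measure_ge0. Qed.

Let cone_measure_sigma_additive : semi_sigma_additive cone_measure.
Proof. exact: measure_semi_sigma_additive. Qed.

HB.instance Definition _ := isMeasure.Build _ _ _ cone_measure
  cone_measure0 cone_measure_ge0 cone_measure_sigma_additive.

(* Surface measure of the unit sphere, by integration in polar coordinates:
   the area of A is n times the volume of the cone over A. *)
Definition sphere_measure : {measure set V -> \bar R} :=
  mscale (n%:R%:nng) cone_measure.

End euclidean_ball.

Section sobolev.
Context {R : realType} {n : nat}.
Local Notation V := 'rV[R]_n.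
Local Notation leb := (lebesgue_rV n : {measure set V -> \bar R}).
Implicit Types (D : set V) (u v : V -> R) (du : 'I_n -> V -> R).

Definition partial (i : 'I_n) u (x : V) : R := 'D_(delta_mx ord0 i) u x.

Fixpoint Ck (k : nat) u : Prop :=
  continuous u /\
  if k is k'.+1 then
    forall i, (forall x, derivable u x (delta_mx ord0 i)) /\ Ck k' (partial i u)
  else True.

Definition test_function D (phi : V -> R) : Prop :=
  (forall k, Ck k phi) /\
  exists K : set V, [/\ compact K, K `<=` D & forall x, ~ K x -> phi x = 0].

Definition L2 (mu : {measure set V -> \bar R}) D u : Prop :=
  u \_ D \in Lfun mu 2%:E.

Definition L2_cvg (mu : {measure set V -> \bar R}) D (u_ : nat -> V -> R) u :
    Prop :=
  ('N[mu]_2%:E[EFin \o ((u_ k \- u)%R \_ D)] @[k --> \oo] --> 0)%E.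

Definition weak_partial D (i : 'I_n) u v : Prop :=
  forall phi, test_function D phi ->
    \int[leb]_(x in D) (u x * partial i phi x) =
    - \int[leb]_(x in D) (v x * phi x).

(* u \in H^1(D) with weak gradient du *)
Definition H1 D u du : Prop :=
  L2 leb D u /\ forall i, L2 leb D (du i) /\ weak_partial D i u (du i).

(* u \in H^2(D) with weak gradient du and weak Hessian d2u *)
Definition H2 D u du (d2u : 'I_n -> 'I_n -> V -> R) : Prop :=
  H1 D u du /\ forall i, H1 D (du i) (d2u i).

Local Notation B := (@unit_ball R n).
Local Notation S := (@unit_sphere R n).

(* t is the boundary trace of the function v of H^1(B), whose weak gradient
   is dv: the trace operator is the continuous extension, from H^1(B) to
   L^2(S), of the restriction to S of the functions of H^1(B) that are
   continuous on the closed ball. *)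
Definition trace v dv (t : V -> R) : Prop :=
  L2 sphere_measure S t /\
  exists (phi : nat -> V -> R) (dphi : nat -> 'I_n -> V -> R),
    [/\ forall k, {within closed_unit_ball, continuous (phi k)} /\
                  H1 B (phi k) (dphi k),
        L2_cvg leb B phi v,
        forall i, L2_cvg leb B (fun k => dphi k i) (dv i) &
        L2_cvg sphere_measure S phi t].

(* vanishing normal derivative on S, in the sense of traces; the outer unit
   normal at x \in S is x *)
Definition neumann du (d2u : 'I_n -> 'I_n -> V -> R) : Prop :=
  exists t : 'I_n -> V -> R,
    (forall i, trace (du i) (d2u i) (t i)) /\
    {ae sphere_measure, forall x, S x -> \sum_i t i x * x ord0 i = 0}.

(* u \in H^2(B) is a solution of
     - Delta u + b(|x|) x . grad u + u = a(|x|) f(u)  a.e. in B,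
     u > 0 in B,  d_nu u = 0 on S *)
Definition solution (a b f : R -> R) u : Prop :=
  exists du d2u,
    [/\ H2 B u du d2u,
        {ae leb, forall x, B x ->
          - (\sum_i d2u i i x)
          + b (enorm x) * (\sum_i x ord0 i * du i x) + u x
          = a (enorm x) * f (u x)},
        forall x, B x -> 0 < u x &
        neumann du d2u].

Definition radial_nondecreasing u : Prop :=
  exists w : R -> R,
    (forall x, B x -> u x = w (enorm x)) /\
    {in `[0, 1[ &, {homo w : r s / r <= s}}.

(* elements of H^2(B) are classes of functions modulo a.e. equality *)
Definition ae_nonconstant u : Prop :=
  ~ exists c : R, {ae leb, forall x, B x -> u x = c}.

End sobolev.

(* f is of class C^1 on A, with one-sided derivatives at the end points *)
Definition C1_on {R : realType} (A : set R) (f : R -> R) : Prop :=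
  exists df : R -> R,
    {within A, continuous df} /\
    forall x, A x ->
      (f y - f x) / (y - x) @[y --> within A x^'] --> df x.

(* Main.v *)
Require Import Defs.
From HB Require Import structures.
From mathcomp Require Import all_boot all_order all_algebra.
From mathcomp Require Import all_classical all_reals all_analysis.
From mathcomp Require Import measurable_realfun.
From mathcomp Require Import ring lra.
Set Implicit Arguments.
Unset Strict Implicit.
Unset Printing Implicit Defensive.
Import Order.TTheory GRing.Theory Num.Theory.
Import numFieldNormedType.Exports.
Local Open Scope classical_set_scope.
Local Open Scope ring_scope.

(* The solution is found by shooting from the centre.  Let [u d] solve the
   radial equation with [u d 0 = d] and [u d' 0 = 0].  Its slope divided by the
   radius, [p d r = u d' r / r], is continuous up to [r = 0] and is the fixed
   point of an averaging operator, which contracts for the weight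
   [exp (lam r^2)]; so [p d] depends continuously on [d].  The set of [d] for
   which [p d >= 0] on [[0, 1]] is closed, contains the small [d] (where
   [a f(u) < u]) but not some large [M] (where [a 0 * f M > M]).  At the
   supremum of that set within [[0, M]] the slope vanishes at some [r0].  If
   [r0 < 1] then [u = a f(u)] at [r0], and since [a] and [f] are nondecreasing
   and [b <= 0], a Gronwall argument shows that [u] is constant on [[r0, 1]].
   Hence [u' 1 = 0] in all cases.  A constant [u] would force [a] to be
   constant.  Finally [u(|x|)] is of class [C^2] on the whole space, so that it
   is in [H^2] with its classical derivatives, the traces being restrictions. *)

(** * Averages of primitives *)

(** The obstacle is the coefficient [(N - 1) / r] of the radial Laplacian, singular at the centre.
    With [n = N - 1], [u' = r p] and [G = u - a f(u) + b r^2 p], the equation reads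
    [(r^n u')' = r^n G]. Integrated, it says that [r^(n+1) p] is the integral of [t^n G] from 0 to
    [r], and the quotient by [r^(n+1)] tends to [G 0 / (n + 1)] at 0. It also says
    [r p' = G - (n + 1) p], so that the Hessian of [u(|x|)] is written with [p] and [G] alone, and
    its continuity at the origin follows from theirs. The contraction requires a globally Lipschitz
    [f]. The lower limit at infinity provides [M] with [M < a 0 * f M], and [f] is frozen beyond
    [M e]. *)

Section primitive.
Context {R : realType}.
Implicit Types (F h k C : R -> R) (x r s t l c : R).

Lemma is_derive1_continuous F (x l : R) : is_derive x 1 F l -> {for x, continuous F}.
Proof.
by move=> [dF _]; apply/differentiable_continuous/derivable1_diffP.
Qed.

Lemma is_derive_derive1 F x l :
  derivable F x 1 -> derive1 F x = l -> is_derive x 1 F l.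
Proof. by move=> dF <-; apply: DeriveDef => //; rewrite derive1E. Qed.

Lemma is_derive1_mul F h x l c : is_derive x 1 F l -> is_derive x 1 h c ->
  is_derive x 1 (fun y => F y * h y) (l * h x + F x * c).
Proof.
move=> dF dh; apply: (is_derive_eq (is_deriveM dF dh)).
by rewrite /GRing.scale/= addrC mulrC.
Qed.

Lemma is_derive1_exp m x : is_derive x 1 (fun y : R => y ^+ m) (m%:R * x ^+ m.-1).
Proof.
rewrite (_ : (fun _ => _) = @id R ^+ m); last by rewrite exprfctE.
apply: (is_derive_eq (is_deriveX m (is_derive_id x 1))).
by rewrite /GRing.scale/= mulr1 -mulr_natl.
Qed.

Lemma is_derive1_inv F x l : F x != 0 -> is_derive x 1 F l ->
  is_derive x 1 (fun y => (F y)^-1) (- l / F x ^+ 2).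
Proof.
move=> F0 dF; apply: (is_derive_eq (is_deriveV F0 dF)).
by rewrite /GRing.scale/= mulrC mulrN mulNr.
Qed.

(** The derivative is required only inside the interval because the equation for the slope divides
    by [r] and is meaningless at [r = 0]. *)
Lemma derivative_le0_le F (dF : R -> R) (s r : R) : s <= r ->
  (forall x : R, s < x < r -> is_derive x 1 F (dF x)) ->
  (forall x : R, s <= x <= r -> {for x, continuous F}) ->
  (forall x : R, s < x < r -> dF x <= 0) -> F r <= F s.
Proof.
move=> sr dFE cF dF0; rewrite -subr_le0.
move: sr; rewrite le_eqVlt => /predU1P[->|sr]; first by rewrite subrr.
have dI x : x \in `]s, r[ -> is_derive x 1 F (dF x).
  by rewrite in_itv/=; exact: dFE.
have cI : {within `[s, r], continuous F}.
  by apply: continuous_in_subspaceT => x; rewrite inE/= in_itv/=; exact: cF.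
have [c + ->] := MVT sr dI cI; rewrite in_itv/= => /dF0 c0.
by rewrite mulr_le0_ge0// subr_ge0 ltW.
Qed.

(** The primitive vanishing at 0. Integrating from -1 makes 0 an interior point, so that the
    derivative at 0 is two-sided. *)
Definition prim h (x : R) : R :=
  \int[lebesgue_measure]_(t in `[-1, x]) h t -
  \int[lebesgue_measure]_(t in `[-1, 0]) h t.

Lemma prim0 h : prim h 0 = 0.
Proof. by rewrite /prim subrr. Qed.

Lemma prim_cst0 x : prim (cst 0) x = 0.
Proof. by rewrite /prim !Rintegral_cst//= !mul0r subrr. Qed.

Lemma is_derive_prim h (x : R) : continuous h -> -1 < x ->
  is_derive x 1 (prim h) (h x).
Proof.
move=> ch x1.
pose I (y : R) : R := \int[lebesgue_measure]_(t in `[-1, y]) h t.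
have xx : x < x + 1 by rewrite ltrDl.
have hI : lebesgue_measure.-integrable `[-1, x + 1] (EFin \o h).
  apply: continuous_compact_integrable; first exact: segment_compact.
  exact: continuous_subspaceT.
have [dI I'] : derivable I x 1 /\ derive1 I x = h x.
  exact: (continuous_FTC1_closed xx hI x1 (ch x)).
have {}dI : is_derive x 1 I (h x).
  exact: is_derive_derive1.
rewrite (_ : prim h = I - cst (I 0)); last exact/funext.
by rewrite -[h x]subr0; exact: is_deriveB.
Qed.

Lemma continuous_prim h (x : R) : continuous h -> -1 < x ->
  {for x, continuous (prim h)}.
Proof. by move=> ch x1; exact/is_derive1_continuous/is_derive_prim. Qed.

(** All integral estimates below come from this comparison: an explicit antiderivative [C] of the
    bound replaces the evaluation of an integral. *)
Lemma prim_sub_le h k C (dC : R -> R) (r : R) : continuous h -> continuous k -> 0 <= r ->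
  (forall x : R, 0 <= x -> {for x, continuous C}) ->
  (forall x : R, 0 < x -> is_derive x 1 C (dC x)) ->
  0 <= C 0 -> (forall x : R, 0 < x < r -> h x - k x <= dC x) ->
  prim h r - prim k r <= C r.
Proof.
move=> ch ck r0 cC dCE C0 hk.
rewrite -subr_le0.
apply: (@le_trans _ _ ((prim h - prim k - C) 0)); last first.
  by rewrite !fctE !prim0 subrr sub0r oppr_le0.
apply: (@derivative_le0_le _ (fun x => h x - k x - dC x) 0 r r0).
- move=> x /andP[x0 xr]; have x1 : -1 < x by lra.
  have := is_derive_prim ch x1; have := is_derive_prim ck x1; have := dCE x x0.
  by move=> ? ? ?; exact: is_deriveB.
- move=> x /andP[x0 xr]; have x1 : -1 < x by lra.
  have c1 := continuous_prim ch x1; have c2 := continuous_prim ck x1.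
  exact: (continuousB (continuousB c1 c2) (cC x x0)).
- by move=> x xr; rewrite subr_le0; exact: hk.
Qed.

End primitive.

Section average.
Context {R : realType} (n : nat).
Implicit Types (h k C : R -> R) (x r s t l c : R).

(* [n.+1^-1] times the mean of the radial function [h] over the ball of radius
   [`|r|] of [R^n.+1], extended by continuity to [r = 0] *)
Definition avg h (r : R) : R :=
  if r == 0 then h 0 / n.+1%:R
  else prim (fun t => t ^+ n * h t) `|r| / `|r| ^+ n.+1.

Lemma avg0 h : avg h 0 = h 0 / n.+1%:R.
Proof. by rewrite /avg eqxx. Qed.

Lemma avg_norm h r : avg h `|r| = avg h r.
Proof. by rewrite /avg normr_eq0 normr_id. Qed.

Lemma avgE h (r : R) : 0 < r -> avg h r = prim (fun t => t ^+ n * h t) r / r ^+ n.+1.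
Proof. by move=> r0; rewrite /avg gt_eqF// gtr0_norm. Qed.

Lemma continuous_expM h : continuous h -> continuous (fun t => t ^+ n * h t).
Proof.
by move=> ch x; apply: cvgM; [exact: exprn_continuous|exact: ch].
Qed.

(** The hypothesis, multiplied by [x ^+ n], bounds the integrand by the derivative of
    [x ^+ n.+1 * C x]. *)
Lemma avg_sub_le h k C (dC : R -> R) (r : R) : continuous h -> continuous k ->
  continuous C -> (forall x : R, 0 < x -> is_derive x 1 C (dC x)) ->
  (forall x : R, 0 <= x <= `|r| -> h x - k x <= n.+1%:R * C x + x * dC x) ->
  avg h r - avg k r <= C `|r|.
Proof.
move=> ch ck cC dCE hk.
have [->|r0] := eqVneq r 0.
  have := hk 0; rewrite normr0 lexx normr_ge0 mul0r addr0 !avg0 => /(_ isT) hk0.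
  by rewrite -mulrBl ler_pdivrMr// mulrC.
rewrite -2![avg _ r]avg_norm.
have {}r0 : 0 < `|r| by rewrite normr_gt0.
move: {r}(`|r| : R) r0 hk => r r0 hk.
rewrite !avgE// -mulrBl ler_pdivrMr ?exprn_gt0//.
rewrite mulrC.
apply: (@prim_sub_le _ _ _ (fun x => x ^+ n.+1 * C x)
  (fun x => x ^+ n * (n.+1%:R * C x + x * dC x))); rewrite ?(ltW r0)//.
- exact: continuous_expM.
- exact: continuous_expM.
- by move=> x x0; apply: cvgM; [exact: exprn_continuous|exact: cC].
- move=> x x0; apply: (is_derive_eq (is_derive1_mul (is_derive1_exp _ _) (dCE x x0))).
  by rewrite /= exprS; ring.
- by rewrite expr0n/= mul0r.
- move=> x /andP[x0 xr]; rewrite -mulrBr ler_wpM2l ?exprn_ge0 ?(ltW x0)//.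
  by apply: hk; rewrite !ltW.
Qed.

Lemma is_derive_avg h (r : R) : continuous h -> 0 < r ->
  is_derive r 1 (avg h) ((h r - n.+1%:R * avg h r) / r).
Proof.
move=> ch r0.
have H : is_derive r 1 (fun x => prim (fun t => t ^+ n * h t) x / x ^+ n.+1)
   ((h r - n.+1%:R * avg h r) / r).
  have r1 : -1 < r by lra.
  have := is_derive_prim (continuous_expM ch) r1 => d1.
  have rn0 : r ^+ n.+1 != 0 by rewrite expf_neq0// gt_eqF.
  have r0' : r != 0 by rewrite gt_eqF.
  have d2 := @is_derive1_inv _ (fun y : R => y ^+ n.+1) r _ rn0 (is_derive1_exp n.+1 r).
  apply: (is_derive_eq (is_derive1_mul d1 d2)).
  rewrite avgE//; move: (prim _ _) => P; rewrite /= !exprS in rn0 *.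
  by field; move: rn0; rewrite mulf_eq0 negb_or r0' => /andP[_ ->].
apply: (near_eq_is_derive _ H); near=> x.
by rewrite avgE//; near: x; exact: lt_nbhsr.
Unshelve. all: by end_near. Qed.

Lemma avg_cst0 r : avg (cst 0) r = 0.
Proof.
rewrite /avg; case: eqP => _; first by rewrite mul0r.
rewrite (_ : (fun _ => _) = cst 0); last by apply/funext => t; rewrite mulr0.
by rewrite prim_cst0 mul0r.
Qed.

Lemma continuous_avg h : continuous h -> continuous (avg h).
Proof.
move=> ch x; have [->|x0] := eqVneq x 0; last first.
  have : {for `|x|, continuous (avg h)}.
    by apply: is_derive1_continuous; apply: is_derive_avg; rewrite ?normr_gt0.
  move=> c1; have {c1} : {for x, continuous (avg h \o (fun y : R => `|y|))}.
    by apply: continuous_comp => //; exact: norm_continuous.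
  suff -> : avg h \o (fun y : R => `|y|) = avg h by [].
  by apply/funext => y /=; exact: avg_norm.
(* At 0, [h] is squeezed between the constants [h 0 - e] and [h 0 + e], whose averages are these
   constants divided by [n.+1]. *)
apply/cvgrPdist_le => e e0; near=> r.
have hr : forall y, 0 <= y <= `|r| -> `|h 0 - h y| <= e.
  near: r.
  have := ch 0 => /cvgrPdist_le /(_ e e0) [d /= d0 hd].
  exists d => // r /=; rewrite sub0r normrN => rd y /andP[y0 yr].
  by apply: hd; rewrite /= sub0r normrN ger0_norm//; exact: le_lt_trans rd.
have e0' := ltW e0.
have N1 : 1 <= n.+1%:R :> R by rewrite ler1n.
have : avg h r - avg (cst 0) r <= (h 0 + e) / n.+1%:R.
  apply: (@avg_sub_le _ _ (cst _) (cst 0)) => // [||y].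
  - exact: cst_continuous.
  - exact: cst_continuous.
  - move=> /hr; rewrite /cst mulr0 addr0 subr0 mulrCA mulfV ?pnatr_eq0// mulr1.
    by rewrite ler_norml => /andP[? ?]; lra.
rewrite avg_cst0 subr0 => up.
have : avg (cst 0) r - avg h r <= (e - h 0) / n.+1%:R.
  apply: (@avg_sub_le _ _ (cst _) (cst 0)) => // [||y].
  - exact: cst_continuous.
  - exact: cst_continuous.
  - move=> /hr; rewrite /cst mulr0 addr0 sub0r mulrCA mulfV ?pnatr_eq0// mulr1.
    by rewrite ler_norml => /andP[? ?]; lra.
rewrite avg_cst0 sub0r => dn.
have eN : e / n.+1%:R <= e by rewrite ler_pdivrMr ?ltr0n// ler_peMr.
rewrite mulrDl in up; rewrite mulrBl in dn.
have dist_le (A B D d : R) : A <= B + D -> - A <= D - B -> D <= d -> `|B - A| <= d.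
  by rewrite ler_norml => *; lra.
by rewrite avg0; exact: dist_le up dn eN.
Unshelve. all: by end_near. Qed.

End average.

(** * Contractions for a weighted norm *)

Section weighted_contraction.
Context {R : realType}.
Implicit Types (p q : R -> R) (x y c d e M : R).

Lemma half_exp_le0 x c : 0 <= c -> (forall k, x <= c * 2^-1 ^+ k) -> x <= 0.
Proof.
move=> c0 xc; rewrite leNgt; apply/negP => x0.
have h k : k%:R <= 2 ^+ k :> R by rewrite -natrX ler_nat ltnW// ltn_expl.
have := xc (Num.bound (c / x)); rewrite leNgt => /negP; apply.
rewrite exprVn ltr_pdivrMr ?exprn_gt0// -ltr_pdivrMl// mulrC.
apply: (lt_le_trans (archi_boundP _)); last exact: h.
by rewrite divr_ge0// ltW.
Qed.

Variables (E : R -> R) (T : (R -> R) -> R -> R).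
Hypothesis cE : continuous E.
Hypothesis E_gt0 : forall x, 0 < E x.
Hypothesis cT : forall p, continuous p -> continuous (T p).
Hypothesis T_contract : forall p q M, continuous p -> continuous q -> 0 <= M ->
  (forall x, `|p x - q x| <= M * E x) ->
  forall x, `|T p x - T q x| <= M / 2 * E x.

(** Banach iteration carried out at each point: successive iterates differ by at most
    [M * 2^-k * E x], hence all later ones stay within twice that distance. *)
Lemma weighted_fixpoint p0 M : continuous p0 -> 0 <= M ->
  (forall x, `|T p0 x - p0 x| <= M * E x) ->
  exists p, [/\ continuous p, T p = p & forall x, `|p x - p0 x| <= 2 * M * E x].
Proof.
move=> cp0 M0 Tp0; pose u k := iter k T p0.
have cu k : continuous (u k) by elim: k => //= k; exact: cT.
pose h k : R := 2^-1 ^+ k.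
have hS k : h k.+1 = h k / 2 by rewrite /h exprSr.
have h0 k : 0 <= h k by rewrite exprn_ge0.
have du k x : `|u k.+1 x - u k x| <= M * h k * E x.
  elim: k x => [|k IH] x; first by rewrite /h expr0 mulr1; exact: Tp0.
  by rewrite hS mulrA; apply: (T_contract (cu _) (cu _) _ IH); exact: mulr_ge0.
(* Nested brackets: the radius shrinks by exactly [M * h k * E x] at each step, which is the bound
   on the displacement of the centre. *)
pose lo k x := u k x - 2 * M * h k * E x.
pose hi k x := u k x + 2 * M * h k * E x.
have loS k x : lo k x <= lo k.+1 x.
  rewrite /lo hS; have := du k x; rewrite ler_norml => /andP[? ?]; lra.
have hiS k x : hi k.+1 x <= hi k x.
  rewrite /hi hS; have := du k x; rewrite ler_norml => /andP[? ?]; lra.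
have ge0 k x : 0 <= 2 * M * h k * E x.
  by rewrite !mulr_ge0// ltW.
have lohi k x : lo k x <= hi k x by have := ge0 k x; rewrite /lo/hi; lra.
have lom k m x : lo k x <= lo (k + m)%N x.
  elim: m => [|m IH]; first by rewrite addn0.
  by rewrite addnS; exact: le_trans (loS _ _).
have him k m x : hi (k + m)%N x <= hi k x.
  elim: m => [|m IH]; first by rewrite addn0.
  by rewrite addnS; exact: le_trans IH.
have lohi2 k m x : lo k x <= hi m x.
  apply: (le_trans (lom k m x)); apply: (le_trans (lohi _ _)).
  by rewrite addnC.
pose p x := sup (range (lo^~ x)).
have hs x : has_sup (range (lo^~ x)).
  split; first by exists (lo 0%N x); exists 0%N.
  by exists (hi 0%N x) => _ [k _ <-].
have pu k x : `|p x - u k x| <= 2 * M * h k * E x.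
  have : lo k x <= p x by apply: ub_le_sup; [case: (hs x)|exists k].
  have : p x <= hi k x.
    by apply: ge_sup; [case: (hs x)|move=> _ [m _ <-]].
  by rewrite /hi/lo ler_norml => *; lra.
have small (c e : R) : 0 <= c -> 0 < e -> exists k, c * h k < e.
  move=> c0 e0; apply: contrapT => /forallNP H.
  have : e <= 0.
    apply: (@half_exp_le0 _ c) => // k; have /negP := H k; by rewrite -leNgt.
  by rewrite leNgt e0.
(* [E] may be unbounded, so convergence is only locally uniform: near [x] the weight stays below
   [E x + 1]. *)
have cp : continuous p.
  move=> x; apply/cvgrPdist_le => e e0.
  have e3 : 0 < e / 3 by rewrite divr_gt0.
  have [|k hk] := small (2 * M * (E x + 1)) (e / 3) _ e3.
    by rewrite !mulr_ge0// addr_ge0// ltW.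
  have nE : \forall y \near x, E y <= E x + 1.
    have /cvgrPdist_le /(_ 1 ltr01) := @cE x.
    by apply: filterS => y; rewrite ler_norml => /andP[? ?]; lra.
  have nu : \forall y \near x, `|u k x - u k y| <= e / 3.
    by have /cvgrPdist_le := cu k x; exact.
  near=> y.
  have Ey : E y <= E x + 1 by near: y.
  have uy : `|u k x - u k y| <= e / 3 by near: y.
  have bnd z : E z <= E x + 1 -> `|p z - u k z| <= e / 3.
    move=> Ez; apply: (le_trans (pu k z)).
    apply: le_trans (ltW hk); rewrite -!mulrA [h k * _]mulrC !ler_wpM2l//.
    by rewrite ler_wpM2r.
  have px := bnd x (ler_wpDr ler01 (lexx _)); have py := bnd y Ey.
  have dist_le (A B C D d : R) : `|A - B| <= d / 3 -> `|B - C| <= d / 3 ->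
      `|D - C| <= d / 3 -> `|A - D| <= d.
    by rewrite !ler_norml => /andP[? ?] /andP[? ?] /andP[? ?]; apply/andP; lra.
  exact: dist_le px uy py.
(* Both [T p] and [p] are within [M * h k * E x] of the iterate [u k.+1]. *)
have Tp x : T p x = p x.
  apply/eqP; rewrite -subr_eq0 -normr_le0.
  apply: (@half_exp_le0 _ (2 * M * E x)); first by rewrite !mulr_ge0// ltW.
  move=> k; have Mh : 0 <= 2 * M * h k by rewrite !mulr_ge0.
  have H := T_contract cp (cu k) Mh (pu k) x.
  have := pu k.+1 x; rewrite hS /= -/(u k).
  have dist_le (A B C d : R) : `|A - B| <= d -> `|C - B| <= d -> `|A - C| <= d + d.
    by rewrite !ler_norml => /andP[? ?] /andP[? ?]; apply/andP; lra.
  rewrite [_ * (h k / 2)]mulrA => /(dist_le _ _ _ _ H) /le_trans; apply.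
  by rewrite -/(h k) le_eqVlt; apply/orP; left; apply/eqP; field.
exists p; split=> //; first exact/funext.
by move=> x; have := pu 0%N x; rewrite /h expr0 mulr1.
Unshelve. all: by end_near. Qed.

(** A bound [m] on the weighted distance improves to [m / 2 + c], and iterating this map leads to
    its fixed point [2 * c]. The a priori bound [M] only starts the iteration. *)
Lemma weighted_stability p q c M : continuous p -> continuous q -> 0 <= M -> 0 <= c ->
  (forall x, `|p x - q x| <= M * E x) -> T p = p ->
  (forall x, `|T q x - q x| <= c * E x) ->
  forall x, `|p x - q x| <= 2 * c * E x.
Proof.
move=> cp cq M0 c0 pq Tp Tq x.
have step k : forall y, `|p y - q y| <= (M * 2^-1 ^+ k + 2 * c) * E y.
  elim: k => [|k IH] y.
    rewrite expr0 mulr1; apply: (le_trans (pq y)).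
    by rewrite ler_wpM2r ?lerDl ?mulr_ge0// ltW.
  have MM : 0 <= M * 2^-1 ^+ k + 2 * c by rewrite addr_ge0 ?mulr_ge0 ?exprn_ge0.
  have := T_contract cp cq MM IH y; rewrite Tp => H.
  rewrite -(subrK (T q y) (p y)) -addrA (le_trans (ler_normD _ _))//.
  apply: (le_trans (lerD H (Tq y))).
  by rewrite -mulrDl ler_wpM2r ?(ltW (E_gt0 y))// exprS; lra.
rewrite -subr_le0.
apply: (@half_exp_le0 _ (M * E x)); first by rewrite mulr_ge0// ltW.
by move=> k; have := step k x; lra.
Qed.

End weighted_contraction.

(** * The radial initial value problem *)

Section radial_ivp.
Context {R : realType} (n : nat) (F : R -> R -> R) (b : R -> R) (L B : R).
Implicit Types (p q : R -> R) (x y r s t c d e M : R).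
Hypothesis L0 : 0 <= L.
Hypothesis cF : forall W : R -> R, continuous W -> continuous (fun t => F t (W t)).
Hypothesis F_lip : forall t s s', `|F t s - F t s'| <= L * `|s - s'|.
Hypothesis F0 : forall t, F t 0 = 0.
Hypothesis cb : continuous b.
Hypothesis b_bnd : forall t, `|b t| <= B.

(* For a radial [u] with [u 0 = d] and [p r = u' r / r], [profile d p] is [u]
   and [rhs d p] is the Laplacian of [u] prescribed by the equation. *)
Definition profile d p t : R := d + prim (fun s => s * p s) `|t|.
Definition rhs d p t : R := F t (profile d p t) + b t * t ^+ 2 * p t.
(** A fixed point is the slope of a solution: by the divergence theorem, [r^(n+1) p = r^n u'] is the
    integral of [t^n] times the Laplacian. *)
Definition step d p : R -> R := avg n (rhs d p).

Lemma continuous_idM p : continuous p -> continuous (fun s => s * p s).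
Proof. by move=> cp x; apply: cvgM; [exact: cvg_id|exact: cp]. Qed.

Lemma continuous_profile d p : continuous p -> continuous (profile d p).
Proof.
move=> cp x; apply: cvgD; first exact: cvg_cst.
apply: (@continuous_comp _ _ _ (fun y : R => `|y|) (prim (fun s => s * p s))).
  exact: norm_continuous.
apply: continuous_prim; first exact: continuous_idM.
by rewrite (lt_le_trans (ltrN10 _)).
Qed.

Lemma continuous_rhs d p : continuous p -> continuous (rhs d p).
Proof.
move=> cp x; apply: cvgD; first by apply: cF; exact: continuous_profile.
by apply: cvgM; [apply: cvgM; [exact: cb|exact: exprn_continuous]|exact: cp].
Qed.

Lemma continuous_step d p : continuous p -> continuous (step d p).
Proof. by move=> cp; apply: continuous_avg; exact: continuous_rhs. Qed.

Let B0 : 0 <= B. Proof. by apply: le_trans (b_bnd 0). Qed.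

(** Large enough for the reaction term ([L <= lam]) and for the drift ([B <= lam]); the summand 1
    makes it positive. *)
Let lam := L + B + 1.
Let lam_gt0 : 0 < lam. Proof. by rewrite /lam; have := L0; have := B0; lra. Qed.

Definition weight r : R := expR (lam * r ^+ 2).

Lemma weight_ge1 r : 1 <= weight r.
Proof. by rewrite -expR0 ler_expR mulr_ge0// ?sqr_ge0 ?ltW. Qed.

Lemma weight_gt0 r : 0 < weight r. Proof. exact: expR_gt0. Qed.

Lemma weight_norm r : weight `|r| = weight r.
Proof. by rewrite /weight real_normK// num_real. Qed.

Lemma is_derive_weight r : is_derive r 1 weight (2 * lam * r * weight r).
Proof.
have d1 := is_derive1_mul (is_derive_cst lam r (1 : R)) (is_derive1_exp 2 r).
apply: (is_derive_eq (is_derive1_comp (is_derive_expR _) d1)).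
by rewrite /GRing.scale/= /cst/= /weight; ring.
Qed.

Lemma continuous_weight : continuous weight.
Proof. by move=> r; exact: is_derive1_continuous (is_derive_weight r). Qed.

(** The factor [s] in [u' = s p] matches the weight: [M / (2 * lam) * weight] is an antiderivative
    of [M * s * weight s], so the integration gains [1 / (2 * lam)]. *)
Lemma profile_dist d d' p q M t : continuous p -> continuous q -> 0 <= M ->
  (forall r, `|p r - q r| <= M * weight r) ->
  `|profile d p t - profile d' q t| <= `|d - d'| + M / (2 * lam) * weight t.
Proof.
move=> cp cq M0 pq.
have half p1 p2 : continuous p1 -> continuous p2 ->
    (forall r, `|p1 r - p2 r| <= M * weight r) ->
    prim (fun s => s * p1 s) `|t| - prim (fun s => s * p2 s) `|t| <=
    M / (2 * lam) * weight `|t|.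
  move=> c1 c2 p12.
  apply: (@prim_sub_le _ _ _ (fun r => M / (2 * lam) * weight r)
    (fun r => M * r * weight r)) => //.
  - exact: continuous_idM.
  - exact: continuous_idM.
  - by move=> x _; apply: cvgM; [exact: cvg_cst|exact: continuous_weight].
  - move=> x _; apply: (is_derive_eq
      (is_derive1_mul (is_derive_cst (M / (2 * lam)) x (1 : R)) (is_derive_weight x))).
    rewrite /cst /= mul0r add0r; by field; rewrite gt_eqF.
  - by rewrite !mulr_ge0 ?invr_ge0 ?mulr_ge0// ltW ?weight_gt0.
  - move=> x /andP[x0 _]; rewrite -mulrBr (_ : M * x * _ = x * (M * weight x)); last by ring.
    rewrite ler_wpM2l ?(ltW x0)//.
    exact: (le_trans (ler_norm _) (p12 x)).
have h1 := half p q cp cq pq.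
have h2 : prim (fun s => s * q s) `|t| - prim (fun s => s * p s) `|t| <=
    M / (2 * lam) * weight `|t|.
  by apply: half => // r; rewrite distrC.
rewrite weight_norm in h1 h2; rewrite /profile opprD addrACA.
apply: (le_trans (ler_normD _ _)); rewrite lerD2l ler_norml.
by apply/andP; split; lra.
Qed.

Lemma rhs_dist d d' p q M t : continuous p -> continuous q -> 0 <= M ->
  (forall r, `|p r - q r| <= M * weight r) ->
  `|rhs d p t - rhs d' q t| <=
    (L * `|d - d'| + L * (M / (2 * lam)) + B * M * t ^+ 2) * weight t.
Proof.
move=> cp cq M0 pq; rewrite /rhs opprD addrACA -mulrBr.
apply: (le_trans (ler_normD _ _)).
rewrite [leRHS]mulrDl lerD//.
  apply: (le_trans (F_lip _ _ _)).
  rewrite -mulrDr -mulrA ler_wpM2l// (le_trans (profile_dist _ _ _ cp cq M0 pq))//.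
  by rewrite mulrDl lerD2r ler_peMr// weight_ge1.
rewrite normrM [X in X * _]normrM (ger0_norm (sqr_ge0 t)).
have := pq t; have := b_bnd t; have := sqr_ge0 t.
move: (weight t) (`|p t - _|) (t ^+ 2) (normr_ge0 (p t - q t)) (normr_ge0 (b t)).
move: `|b t| => bt w pt t2 pt0 bt0 t20 btB ptw.
rewrite (_ : B * M * t2 * w = B * t2 * (M * w)); last by ring.
by rewrite ler_pM// ?mulr_ge0// ler_wpM2r.
Qed.

Lemma step_dist d d' p q M t : continuous p -> continuous q -> 0 <= M ->
  (forall r, `|p r - q r| <= M * weight r) ->
  `|step d p t - step d' q t| <= (M / 2 + L * `|d - d'|) * weight t.
Proof.
have half d1 d2 p1 p2 : continuous p1 -> continuous p2 -> 0 <= M ->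
    (forall r, `|p1 r - p2 r| <= M * weight r) ->
    step d1 p1 t - step d2 p2 t <= (M / 2 + L * `|d1 - d2|) * weight `|t|.
  move=> c1 c2 M0 p12.
  pose c := M / 2 + L * `|d1 - d2|.
  have c0 : 0 <= c by rewrite addr_ge0 ?divr_ge0 ?mulr_ge0.
  apply: (@avg_sub_le _ _ _ _ (fun r => c * weight r)
    (fun r => c * (2 * lam * r * weight r))).
  - exact: continuous_rhs.
  - exact: continuous_rhs.
  - by move=> x; apply: cvgM; [exact: cvg_cst|exact: continuous_weight].
  - move=> x _; apply: (is_derive_eq
      (is_derive1_mul (is_derive_cst c x (1 : R)) (is_derive_weight x))).
    by rewrite /cst mul0r add0r.
  move=> x x0; apply: (le_trans (ler_norm _)).
  apply: (le_trans (rhs_dist d1 d2 x c1 c2 M0 p12)).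
  (* The two terms are compared separately: [L * M / (2 * lam) <= M / 2] controls the constant one,
     and [B * M <= lam * M <= 2 * lam * c] the coefficient of [x ^+ 2]. *)
  have -> : n.+1%:R * (c * weight x) + x * (c * (2 * lam * x * weight x)) =
     (n.+1%:R * c + 2 * lam * c * x ^+ 2) * weight x by ring.
  rewrite ler_wpM2r ?(ltW (weight_gt0 _))// lerD//.
    apply: (@le_trans _ _ c); last by rewrite ler_peMl// ler1n.
    rewrite /c addrC lerD2r mulrA ler_pdivrMr ?mulr_gt0//.
    rewrite [M / 2 * _]mulrA divfK// mulrC ler_wpM2l// /lam; have := L0; have := B0; lra.
  rewrite ler_wpM2r ?sqr_ge0//.
  apply: (@le_trans _ _ (lam * M)).
    by rewrite ler_wpM2r// /lam; have := L0; have := B0; lra.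
  rewrite -mulrA mulrCA ler_wpM2l ?(ltW lam_gt0)// /c mulrDr.
  rewrite mulrC divfK// lerDl !mulr_ge0//.
move=> cp cq M0 pq.
have h1 := half d d' p q cp cq M0 pq.
have h2 : step d' q t - step d p t <= (M / 2 + L * `|d - d'|) * weight `|t|.
  by rewrite (distrC d d'); apply: half => // r; rewrite distrC.
rewrite weight_norm in h1 h2; rewrite ler_norml.
by apply/andP; split; lra.
Qed.

Let step_contract d p q M : continuous p -> continuous q -> 0 <= M ->
  (forall x, `|p x - q x| <= M * weight x) ->
  forall x, `|step d p x - step d q x| <= M / 2 * weight x.
Proof.
move=> cp cq M0 pq x; apply: (le_trans (step_dist d d x cp cq M0 pq)).
by rewrite subrr normr0 mulr0 addr0.
Qed.

(** Comparison with this trivial solution bounds the defect of the initial guess [cst 0] for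
    [step d] by [L * |d|]. *)
Lemma step00 : step 0 (cst 0) = cst 0.
Proof.
have Q0 : (fun s => s * cst 0 s) = cst 0 by apply/funext => s; rewrite mulr0.
rewrite /step (_ : rhs _ _ = cst 0); first by apply/funext => r; rewrite avg_cst0.
apply/funext => t.
by rewrite /rhs /profile Q0 prim_cst0 addr0 F0 /= mulr0 addr0.
Qed.

Lemma radial_ivp_ex d : exists p, [/\ continuous p, step d p = p &
  forall x, `|p x| <= 2 * (L * `|d|) * weight x].
Proof.
have c0 : continuous (cst 0 : R -> R) by exact: cst_continuous.
have Ld : 0 <= L * `|d| by rewrite mulr_ge0.
have H0 x : `|step d (cst 0) x - cst 0 x| <= L * `|d| * weight x.
  have H r : `|cst 0 r - cst 0 r : R| <= 0 * weight r.
    by rewrite subrr normr0 mul0r.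
  by have := step_dist d 0 x c0 c0 (lexx _) H; rewrite step00 mul0r add0r (subr0 d).
have [p [cp Tp pE]] := weighted_fixpoint continuous_weight weight_gt0
  (@continuous_step d) (@step_contract d) c0 Ld H0.
by exists p; split=> // x; have := pE x; rewrite subr0.
Qed.

Definition ivp d : R -> R := projT1 (cid (radial_ivp_ex d)).

Lemma continuous_ivp d : continuous (ivp d).
Proof. by rewrite /ivp; case: cid => p []. Qed.

Lemma ivpE d : ivp d = avg n (rhs d (ivp d)).
Proof. by rewrite /ivp; case: cid => p []. Qed.

Lemma ivp_bound d x : `|ivp d x| <= 2 * (L * `|d|) * weight x.
Proof. by rewrite /ivp; case: cid => p []. Qed.

(** The slope for [d'] is an approximate fixed point of [step d], with defect [L * |d - d'|], so
    stability of fixed points applies. *)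
Lemma ivp_dist d d' x : `|ivp d x - ivp d' x| <= 2 * (L * `|d - d'|) * weight x.
Proof.
pose M := 2 * (L * `|d|) + 2 * (L * `|d'|).
have M0 : 0 <= M by rewrite addr_ge0 ?mulr_ge0.
have c0 : 0 <= L * `|d - d'| by rewrite mulr_ge0.
have pq y : `|ivp d y - ivp d' y| <= M * weight y.
  rewrite /M mulrDl; apply: (le_trans (ler_normB _ _)).
  by apply: lerD; exact: ivp_bound.
have Tq y : `|step d (ivp d') y - ivp d' y| <= L * `|d - d'| * weight y.
  rewrite {2}ivpE.
  have H r : `|ivp d' r - ivp d' r| <= 0 * weight r.
    by rewrite subrr normr0 mul0r.
  have := step_dist d d' y (@continuous_ivp d') (@continuous_ivp d') (lexx _) H.
  by rewrite mul0r add0r.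
exact: (weighted_stability weight_gt0 (@step_contract d) (@continuous_ivp d)
  (@continuous_ivp d') M0 c0 pq (esym (ivpE d)) Tq).
Qed.

End radial_ivp.

(** * Shooting *)

Section radial_solution.
Context {R : realType} (n : nat) (F : R -> R -> R) (b : R -> R) (d : R) (p : R -> R).
Implicit Types (x y r s t c e M : R).
Hypothesis cF : forall W : R -> R, continuous W -> continuous (fun t => F t (W t)).
Hypothesis cb : continuous b.
Hypothesis cp : continuous p.
Hypothesis pE : p = avg n (rhs F b d p).

Local Notation u := (profile d p).
Local Notation Gam := (rhs F b d p).

Lemma profile0 : u 0 = d.
Proof. by rewrite /profile normr0 prim0 addr0. Qed.

Lemma is_derive_profile r : 0 < r -> is_derive r 1 u (r * p r).
Proof.
move=> r0; have r1 : -1 < r by apply: lt_trans r0; rewrite ltrN10.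
have dP := is_derive_prim (continuous_idM cp) r1.
have dU : is_derive r 1 (cst d + prim (fun s => s * p s)) (r * p r).
  by rewrite -[r * p r]add0r; exact: is_deriveD.
apply: (near_eq_is_derive _ dU); near=> x.
by rewrite /profile gtr0_norm//; near: x; exact: lt_nbhsr.
Unshelve. all: by end_near. Qed.

Lemma is_derive_slope r : 0 < r -> is_derive r 1 p ((Gam r - n.+1%:R * p r) / r).
Proof.
move=> r0; rewrite {1 3}pE; apply: is_derive_avg => //.
exact: continuous_rhs.
Qed.

Lemma slope0 : n.+1%:R * p 0 = F 0 d.
Proof.
rewrite pE avg0 mulrC divfK ?pnatr_eq0//.
by rewrite /rhs profile0 expr0n/= mulr0 mul0r addr0.
Qed.

Lemma profile_homo s r : 0 <= s -> s <= r ->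
  (forall x, s < x < r -> 0 <= p x) -> u s <= u r.
Proof.
move=> s0 sr p0; rewrite -lerN2.
apply: (@derivative_le0_le _ (- u) (fun x => - (x * p x)) s r sr).
- move=> x /andP[sx xr]; have x0 := le_lt_trans s0 sx.
  by have := is_derive_profile x0 => dx; exact: is_deriveN.
- by move=> x _; apply: continuousN; exact: continuous_profile.
- move=> x sxr; rewrite oppr_le0 mulr_ge0 ?p0//.
  by case/andP: sxr => sx _; rewrite ltW// (le_lt_trans s0).
Qed.

(* [v = u' = r p] satisfies [v' <= u - c], hence [(u - c + v)' <= u - c + v]. *)
Lemma profile_gronwall c s r : 0 <= s -> s <= r ->
  (forall x, s < x < r -> 0 <= p x) ->
  (forall x, s < x < r -> Gam x <= u x - c) ->
  u r - c + r * p r <= (u s - c + s * p s) * expR (r - s).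
Proof.
move=> s0 sr p0 Gc.
pose phi x : R := (u x - c + x * p x) * expR (- x).
suff : phi r <= phi s.
  rewrite /phi !expRN ler_pdivrMr ?expR_gt0// => /le_trans; apply.
  by rewrite expRD expRN mulrA mulrAC.
pose dphi x : R := (x * p x + (p x + x * ((Gam x - n.+1%:R * p x) / x))) * expR (- x)
   - (u x - c + x * p x) * expR (- x).
apply: (@derivative_le0_le _ phi dphi s r sr).
- move=> x /andP[sx xr]; have x0 := le_lt_trans s0 sx.
  have d1 := is_derive_profile x0.
  have d2 := is_derive1_mul (is_derive_id x (1 : R)) (is_derive_slope x0).
  have d3 : is_derive x 1 (fun y : R => expR (- y)) (- expR (- x)).
    apply: (is_derive_eq (is_derive1_comp (is_derive_expR _) (is_deriveNid x (1 : R)))).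
    by rewrite /GRing.scale/= mulrN1.
  have d4 : is_derive x 1 (fun y : R => u y - c + y * p y)
     (x * p x + (p x + x * ((Gam x - n.+1%:R * p x) / x))).
    apply: (is_derive_eq (is_deriveD (is_deriveB d1 (is_derive_cst c x (1 : R))) d2)).
    by rewrite subr0 mul1r.
  apply: (is_derive_eq (is_derive1_mul d4 d3)).
  by rewrite /dphi mulrN.
- move=> x _; apply: cvgM.
    apply: cvgD; last exact: continuous_idM.
    by apply: cvgB; [exact: continuous_profile|exact: cvg_cst].
  apply: (@continuous_comp _ _ _ (fun y : R => - y) expR).
    exact: opp_continuous.
  exact: continuous_expR.
- move=> x sxr; have := p0 x sxr; have := Gc x sxr.
  case/andP: sxr => sx _; have x0 := le_lt_trans s0 sx.
  rewrite /dphi -mulrBl => G1 p1; apply: mulr_le0_ge0; last exact: expR_ge0.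
  rewrite [x * (_ / x)]mulrC divfK ?gt_eqF//.
  (* Here [v' = p + r p' = Gam - n p]: the [p] of the product rule cancels one of the [n.+1] copies,
     and what remains has the favourable sign. *)
  have : 0 <= n%:R * p x by rewrite mulr_ge0.
  by rewrite -natr1 mulrDl mul1r; lra.
Qed.

End radial_solution.

Section shooting.
Context {R : realType} (n : nat) (a b f : R -> R) (A B L M s0 : R).
Implicit Types (x y r s t c d e : R).
Hypothesis ca : continuous a.
Hypothesis cb : continuous b.
Hypothesis a_bnd : forall t, `|a t| <= A.
Hypothesis b_bnd : forall t, `|b t| <= B.
Hypothesis a_gt0 : 0 < a 0.
Hypothesis a_homo : forall r s, 0 <= r -> r <= s -> s <= 1 -> a r <= a s.
Hypothesis b_le0 : forall r, 0 <= r <= 1 -> b r <= 0.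
Hypothesis L0 : 0 <= L.
Hypothesis f_lip : forall s t, `|f s - f t| <= L * `|s - t|.
Hypothesis f_homo : forall s t, 0 <= s -> s <= t -> f s <= f t.
Hypothesis f0 : f 0 = 0.
Hypothesis s0_gt0 : 0 < s0.
Hypothesis f_small : forall s, 0 < s <= s0 -> a 1 * f s < s.
Hypothesis M_gt0 : 0 < M.
Hypothesis f_large : M < a 0 * f M.

Definition reaction t s : R := s - a t * f s.
Local Notation F := reaction.

Lemma lipschitz_continuous : continuous f.
Proof.
move=> x; apply/cvgrPdist_le => e e0.
have L1 : 0 < L + 1 by rewrite ltr_wpDl.
near=> y; apply: (le_trans (f_lip _ _)).
apply: (@le_trans _ _ ((L + 1) * `|x - y|)); first by rewrite ler_wpM2r// lerDl.
rewrite mulrC -ler_pdivlMr//; near: y.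
have /cvgrPdist_le : (id : R -> R) y @[y --> x] --> x by exact: cvg_id.
by apply; rewrite divr_gt0.
Unshelve. all: by end_near. Qed.

Lemma continuous_reaction (W : R -> R) :
  continuous W -> continuous (fun t => F t (W t)).
Proof.
move=> cW x; apply: cvgB; first exact: cW.
apply: cvgM; first exact: ca.
by apply: continuous_comp; [exact: cW|exact: lipschitz_continuous].
Qed.

Lemma A_ge0 : 0 <= A. Proof. exact: le_trans (a_bnd 0). Qed.

Let Lr := 1 + A * L.

Lemma reaction_lip t s s' : `|F t s - F t s'| <= Lr * `|s - s'|.
Proof.
rewrite /F opprD opprK addrACA [- _ + _]addrC -mulrBr mulrDl mul1r.
apply: (le_trans (ler_normD _ _)); rewrite lerD2l normrM -mulrA distrC.
by rewrite ler_pM// distrC.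
Qed.

Lemma reaction_lip_ge0 : 0 <= Lr.
Proof. by rewrite addr_ge0// mulr_ge0// A_ge0. Qed.

Lemma reaction0 t : F t 0 = 0.
Proof. by rewrite /F f0 mulr0 subr0. Qed.

Let p d := ivp n reaction_lip_ge0 continuous_reaction reaction_lip reaction0 cb b_bnd d.
Local Notation u d := (profile d (p d)).
Local Notation Gam d := (rhs F b d (p d)).

Let cp d : continuous (p d). Proof. exact: continuous_ivp. Qed.
Let pE d : p d = avg n (rhs F b d (p d)). Proof. exact: ivpE. Qed.

(** A Lipschitz constant of [d |-> p d], uniform on [[0, 1]], where the weight is largest at 1. *)
Let K := 2 * Lr * weight Lr B 1.

Let K_ge0 : 0 <= K.
Proof. by rewrite !mulr_ge0 ?reaction_lip_ge0// ltW// weight_gt0. Qed.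

Let weight_le r : 0 <= r <= 1 -> weight Lr B r <= weight Lr B 1.
Proof.
move=> /andP[r0 r1]; have := reaction_lip_ge0; have := le_trans (normr_ge0 _) (b_bnd 0).
by move=> B0 ?; rewrite ler_expR ler_wpM2l ?expr1n ?exprn_ile1//; lra.
Qed.

Let p_dist d d' r : 0 <= r <= 1 -> `|p d r - p d' r| <= K * `|d - d'|.
Proof.
move=> r01; apply: (le_trans (ivp_dist _ _ _ _ _ _ _ _ _ _)).
rewrite /K mulrA mulrAC ler_wpM2r// ler_wpM2l ?weight_le//.
by rewrite mulr_ge0// reaction_lip_ge0.
Qed.

Let p_bound d r : 0 <= r <= 1 -> `|p d r| <= K * `|d|.
Proof.
move=> r01; apply: (le_trans (ivp_bound _ _ _ _ _ _ _ _ _)).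
rewrite /K mulrA mulrAC ler_wpM2r// ler_wpM2l ?weight_le//.
by rewrite mulr_ge0// reaction_lip_ge0.
Qed.

Let GamE d r : Gam d r = u d r - a r * f (u d r) + b r * r ^+ 2 * p d r.
Proof. by []. Qed.

Let a_ge0 r : 0 <= r <= 1 -> 0 <= a r.
Proof. by move=> /andP[r0 r1]; exact: le_trans (ltW a_gt0) (a_homo _ _ _). Qed.

Let f_ge0 s : 0 <= s -> 0 <= f s.
Proof. by move=> s_ge0; rewrite -f0; exact: f_homo. Qed.

Let bp_le0 d r : 0 <= r <= 1 -> 0 <= p d r -> b r * r ^+ 2 * p d r <= 0.
Proof.
by move=> r01 p0; rewrite !mulr_le0_ge0 ?b_le0 ?sqr_ge0.
Qed.

Let nonneg d := forall r, 0 <= r <= 1 -> 0 <= p d r.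

Let profile_ge d r : 0 <= d -> nonneg d -> 0 <= r <= 1 -> d <= u d r.
Proof.
move=> d0 pd /andP[r0 r1].
rewrite -{1}(profile0 d (p d)); apply: (profile_homo d (@cp d)) => // x /andP[x0 xr].
by apply: pd; rewrite ltW//= (le_trans (ltW xr)).
Qed.

(** Gronwall with [c = 0]: the terms [- a f(u)] and [b r^2 p] are nonpositive, so the Laplacian is
    at most [u]. This bound fixes the truncation level of [f]. *)
Let profile_le d r : 0 <= d -> nonneg d -> 0 <= r <= 1 -> u d r <= d * expR 1.
Proof.
move=> d0 pd /andP[r0 r1].
have := @profile_gronwall _ n F b d (p d) continuous_reaction cb (@cp d) (pE d)
  0 0 r (lexx 0) r0.
rewrite profile0 !subr0 mul0r addr0 => H.
have sub x : 0 < x < r -> 0 <= x <= 1.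
  by move=> /andP[x0 xr]; rewrite ltW//= (le_trans (ltW xr)).
have {}H : u d r + r * p d r <= d * expR r.
  apply: H => x xr; have x01 := sub _ xr; first exact: pd.
  have u0 := le_trans d0 (profile_ge d0 pd x01).
  have := bp_le0 x01 (pd _ x01); have : 0 <= a x * f (u d x).
    by rewrite mulr_ge0 ?a_ge0 ?f_ge0.
  by rewrite GamE subr0; lra.
have : 0 <= r * p d r by rewrite mulr_ge0// pd// r0.
have : d * expR r <= d * expR 1 by rewrite ler_wpM2l// ler_expR.
by lra.
Qed.

(* At a zero [r0 < 1] of [p] the reaction term vanishes; as [a] and [f] are
   nondecreasing, it is at most [u - u r0] beyond [r0], so [u] is constant there. *)
Let touching d r0 : 0 <= d -> nonneg d -> 0 <= r0 <= 1 -> p d r0 = 0 -> p d 1 = 0.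
Proof.
move=> d0 pd /andP[r0_ge0]; rewrite le_eqVlt => /predU1P[->//|r0_lt1] pr0.
have r0_01 : 0 <= r0 <= 1 by rewrite r0_ge0 ltW.
(* For [r0 = 0] this is the equation at the centre. Otherwise [r0] is an interior minimum of
   [p >= 0], so [p' r0 = 0] and, with [p r0 = 0], the equation leaves [Gam r0 = 0]. *)
have g0 : u d r0 = a r0 * f (u d r0).
  have [r00|r0_neq0] := eqVneq r0 0.
    have := slope0 (pE d); rewrite -[in LHS]r00 pr0 mulr0 r00 profile0 => /esym/eqP.
    by rewrite subr_eq0 => /eqP.
  have r0_gt0 : 0 < r0 by rewrite lt_neqAle eq_sym r0_neq0.
  have dp := is_derive_slope continuous_reaction cb (@cp d) (pE d).
  have der x : x \in `]0, 1[ -> derivable (p d) x 1.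
    by rewrite in_itv/= => /andP[x0 _]; have [] := dp x x0.
  have r0I : r0 \in `]0, 1[ by rewrite in_itv/= r0_gt0.
  have pmin x : x \in `]0, 1[ -> p d r0 <= p d x.
    by rewrite in_itv/= pr0 => /andP[x0 x1]; rewrite pd// !ltW.
  have [_ d1] := derive1_at_min ler01 der r0I pmin.
  have [_] := dp r0 r0_gt0; rewrite d1 pr0 mulr0 subr0 => /esym/eqP.
  rewrite mulf_eq0 invr_eq0 (negbTE r0_neq0) orbF GamE pr0 mulr0 addr0 subr_eq0.
  by move/eqP.
(* With [c = u r0] the initial value in Gronwall's inequality is zero, so [u 1 - u r0 + p 1 <= 0], a
   sum of two nonnegative quantities. *)
have := @profile_gronwall _ n F b d (p d) continuous_reaction cb (@cp d) (pE d)
  (u d r0) r0 1 r0_ge0 (ltW r0_lt1).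
rewrite subrr pr0 mulr0 addr0 mul0r mul1r => H.
have sub x : r0 < x < 1 -> 0 <= x <= 1.
  by move=> /andP[x0 xr]; rewrite !ltW// (le_lt_trans r0_ge0).
have homo x : r0 <= x <= 1 -> u d r0 <= u d x.
  move=> /andP[r0x x1]; apply: (profile_homo d (@cp d)) => // y /andP[r0y yx].
  by apply/pd/sub; rewrite r0y (lt_le_trans yx).
have {}H : u d 1 - u d r0 + p d 1 <= 0.
  apply: H => x xr; have x01 := sub _ xr; first exact: pd.
  have r0x : r0 <= x <= 1 by case/andP: xr => *; rewrite !ltW.
  have u0 := le_trans d0 (profile_ge d0 pd r0_01).
  have := bp_le0 x01 (pd _ x01).
  have : a r0 * f (u d r0) <= a x * f (u d x).
    case/andP: r0x => r0x x1.
    by rewrite ler_pM ?a_ge0 ?f_ge0 ?a_homo ?f_homo ?homo// r0x.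
  by rewrite GamE -g0; lra.
have := homo 1; rewrite lexx ltW// => /(_ isT) u1.
by apply/eqP; rewrite eq_le pd ?ler01 ?lexx//; lra.
Qed.

(** Otherwise [a 1 * f M < M < a 0 * f M], against the monotonicity of [a]. *)
Let s0M : s0 < M.
Proof.
rewrite ltNge; apply/negP => Ms0.
have := f_small (s := M); rewrite M_gt0 Ms0 => /(_ isT).
rewrite ltNge => /negP; apply; apply: (le_trans (ltW f_large)).
by rewrite ler_wpM2r ?f_ge0 ?(ltW M_gt0)// a_homo ?ler01 ?lexx.
Qed.

(** As long as [0 < u <= s0], the reaction term is positive; at a first zero of [p] the slope would
    then be increasing, although it was positive before. *)
Let small_nonneg : exists2 d, 0 < d <= M & nonneg d.
Proof.
have K1 : 0 < 1 + K by rewrite ltr_wpDr.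
(* Since [u' = r p <= K * d] on [[0, 1]], this choice gives [u <= d + K * d = s0] there, whatever
   the sign of [p]. *)
pose d := s0 / (1 + K).
have d0 : 0 < d by rewrite divr_gt0.
have dM : d <= M.
  by rewrite (le_trans _ (ltW s0M))// ler_pdivrMr// ler_peMr ?lerDl// ltW.
have us0 r : 0 <= r <= 1 -> u d r <= s0.
  move=> /andP[r0 r1]; rewrite /profile (ger0_norm r0).
  have -> : s0 = d + K * d by rewrite -[X in X + _]mul1r -mulrDl mulrC divfK// gt_eqF.
  rewrite lerD2l; apply: (@le_trans _ _ (K * d * r)); last first.
    by rewrite ler_piMr// mulr_ge0// ltW.
  rewrite -[leLHS]subr0 -(prim_cst0 r).
  apply: (@prim_sub_le _ _ _ (fun x => K * d * x) (fun=> K * d)) => //.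
  - exact: continuous_idM.
  - exact: cst_continuous.
  - by move=> x _; apply: cvgM; [exact: cvg_cst|exact: cvg_id].
  - move=> x _; apply: (is_derive_eq
      (is_derive1_mul (is_derive_cst (K * d) x (1 : R)) (is_derive_id x (1 : R)))).
    by rewrite mul0r add0r mulr1.
  - by rewrite mulr0.
  - move=> x /andP[x0 xr]; rewrite subr0.
    have x1 : x <= 1 by rewrite (le_trans (ltW xr)).
    have x01 : 0 <= x <= 1 by rewrite ltW.
    apply: (@le_trans _ _ `|p d x|).
      rewrite (le_trans (ler_norm _))// normrM (gtr0_norm x0) ler_piMl//.
    by rewrite -[X in K * X](gtr0_norm d0) p_bound.
exists d; first by rewrite d0.
(* The infimum [r1] of [Z] plays the role of the first zero of [p]. *)
pose Z : set R := [set r | 0 <= r <= 1 /\ p d r <= 0].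
have Z0 : Z = set0.
  apply/eqP/negPn/negP => /set0P Zne.
  have lbZ : lbound Z 0 by move=> x [/andP[]].
  have hiZ : has_inf Z by split=> //; exists 0.
  pose r1 : R := inf Z.
  have r1_ge0 : 0 <= r1 by apply: lb_le_inf.
  have below r : 0 <= r -> r < r1 -> 0 < p d r.
    move=> r0 rr1; rewrite ltNge; apply/negP => pr.
    have [z [/andP[z0 z1] pz]] := Zne.
    have r1z : r1 <= z by apply: (ge_inf hiZ.2); split => //; rewrite z0 z1.
    have r_1 : r <= 1 by rewrite ltW// (lt_le_trans rr1)// (le_trans r1z).
    have : r1 <= r by apply: (ge_inf hiZ.2); split => //; rewrite r0 r_1.
    by rewrite leNgt rr1.
  have r1_le1 : r1 <= 1.
    have [z [/andP[z0 z1] pz]] := Zne; apply: (le_trans _ z1).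
    by apply: (ge_inf hiZ.2); split => //; rewrite z0 z1.
  have r1_01 : 0 <= r1 <= 1 by rewrite r1_ge0.
  have pr1 : p d r1 <= 0.
    rewrite leNgt; apply/negP => pr1.
    have /cvgr_gt /(_ _ pr1) [e /= e0 near_r1] := @cp d r1.
    have [z Zz zr1] := inf_adherent e0 hiZ.
    have r1z : r1 <= z by exact: ge_inf hiZ.2 _ Zz.
    have := near_r1 z; rewrite /= distrC ger0_norm ?subr_ge0// ltrBlDl => /(_ zr1).
    by case: Zz => _; rewrite leNgt => /negP.
  (* At the centre [n.+1 * p 0 = d - a 0 * f d] is positive, as [d <= s0]. *)
  have r1_neq0 : r1 != 0.
    apply/eqP => r10; have := slope0 (pE d); rewrite r10 in pr1.
    have : 0 < F 0 d.
      rewrite subr_gt0; apply: le_lt_trans (f_small (s := d) _).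
        by rewrite ler_wpM2r ?f_ge0 ?(ltW d0)// a_homo ?ler01 ?lexx.
      by rewrite d0 ler_pdivrMr// ler_peMr ?lerDl// ltW.
    by move=> g0 pg; move: g0; rewrite -pg pmulr_rgt0// ltNge pr1.
  have r1_gt0 : 0 < r1 by rewrite lt_neqAle eq_sym r1_neq0.
  have pos x : 0 <= x -> x < r1 -> 0 <= p d x by move=> *; exact/ltW/below.
  have du : d <= u d r1.
    rewrite -{1}(profile0 d (p d)); apply: (profile_homo d (@cp d)) => // x /andP[x0 xr].
    by apply: pos => //; exact: ltW.
  have pr10 : p d r1 = 0.
    apply/eqP; rewrite eq_le pr1/= leNgt; apply/negP => pneg.
    have /cvgr_lt /(_ _ pneg) [e /= e0 near_r1] := @cp d r1.
    pose m := Num.min (e / 2) r1.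
    have m0 : 0 < m by rewrite lt_min r1_gt0 divr_gt0.
    have mr : 0 <= r1 - m by rewrite subr_ge0 ge_min lexx orbT.
    have mr1 : r1 - m < r1 by rewrite ltrBlDl ltrDr.
    have := near_r1 (r1 - m); rewrite /= opprB addrC subrK gtr0_norm//.
    have me : m < e by rewrite gt_min ltr_pdivrMr// ltr_pMr// ltr1n.
    by move=> /(_ me); rewrite ltNge pos.
  have G0 : 0 < Gam d r1.
    rewrite GamE pr10 mulr0 addr0 subr_gt0.
    have u0 : 0 < u d r1 by exact: lt_le_trans du.
    apply: le_lt_trans (f_small (s := u d r1) _); last by rewrite u0 us0.
    by rewrite ler_wpM2r ?f_ge0 ?(ltW u0)// a_homo ?ler01 ?lexx.
  have cD : continuous (fun x => Gam d x - n.+1%:R * p d x).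
    move=> x; apply: cvgB; first exact: (continuous_rhs continuous_reaction cb (@cp d)).
    by apply: cvgM; [exact: cvg_cst|exact: cp].
  have D0 : 0 < Gam d r1 - n.+1%:R * p d r1 by rewrite pr10 mulr0 subr0.
  have /cvgr_gt /(_ _ D0) [e /= e0 near_r1] := cD r1.
  pose m := Num.min (e / 2) (r1 / 2).
  have m0 : 0 < m by rewrite lt_min !divr_gt0.
  have mr : 0 < r1 - m.
    by rewrite subr_gt0 gt_min [X in _ || X]ltr_pdivrMr// ltr_pMr// ltr1n orbT.
  have mr1 : r1 - m < r1 by rewrite ltrBlDl ltrDr.
  have me : m < e by rewrite gt_min ltr_pdivrMr// ltr_pMr// ltr1n.
  (* On [[r1 - m, r1]] the numerator [Gam - n.+1 * p] of [p'] stays positive, hence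
     [p (r1 - m) <= p r1 = 0], against positivity before [r1]. *)
  have : - p d r1 <= - p d (r1 - m).
    apply: (@derivative_le0_le _ (- p d)
      (fun x => - ((Gam d x - n.+1%:R * p d x) / x)) _ _ (ltW mr1)).
    - move=> x /andP[xl xr]; have x0 := lt_trans mr xl.
      have := is_derive_slope continuous_reaction cb (@cp d) (pE d) x0 => dx.
      exact: is_deriveN.
    - by move=> x _; apply: continuousN; exact: cp.
    - move=> x /andP[xl xr]; have x0 := lt_trans mr xl.
      rewrite oppr_le0 divr_ge0 ?(ltW x0)// ltW// near_r1//=.
      by rewrite gtr0_norm ?subr_gt0//; lra.
  by rewrite lerN2 leNgt pr10 below// ltW.
move=> r r01; rewrite leNgt; apply/negP => pr.
suff : Z r by rewrite Z0.
by split=> //; exact: ltW.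
Qed.

Let shooting : exists d, [/\ 0 < d <= M, nonneg d & p d 1 = 0].
Proof.
have [dl /andP[dl0 dlM] dln] := small_nonneg.
pose D : set R := [set d | dl <= d <= M /\ nonneg d].
have supD : has_sup D.
  split; first by exists dl; split; rewrite ?lexx.
  by exists M => d [/andP[]].
pose s : R := sup D.
have dls : dl <= s by apply: ub_le_sup; [case: supD|split; rewrite ?lexx].
have sM : s <= M by apply: ge_sup; [case: supD|move=> d [/andP[]]].
have s_gt0 : 0 < s by exact: lt_le_trans dls.
have small (e : R) : 0 < e -> exists2 y, 0 < y & K * y < e.
  have K1 : 0 < K + 1 by rewrite ltr_wpDl.
  move=> e0; exists (e / (K + 1)); first by rewrite divr_gt0.
  by rewrite mulrCA gtr_pMr// ltr_pdivrMr// mul1r ltrDl.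
(* Closedness: a negative value of [p s] would persist for the members of [D] close to [s]. *)
have sD : nonneg s.
  move=> r r01; rewrite leNgt; apply/negP => pr.
  have [|y y0 Ky] := small (- p s r); first by rewrite oppr_gt0.
  have [d Dd sd] := sup_adherent y0 supD.
  have ds : d <= s by apply: ub_le_sup => //; case: supD.
  have := p_dist s d r01; rewrite [X in K * X]ger0_norm ?subr_ge0//.
  have : K * (s - d) <= K * y by rewrite ler_wpM2l//; rewrite -/s in sd; lra.
  by have := Dd.2 r r01; rewrite ler_norml => ? ? /andP[? ?]; lra.
(* For [d = M] the slope is negative already at the centre, where [n.+1 * p 0 = M - a 0 * f M]. *)
have sltM : s < M.
  rewrite lt_neqAle sM andbT; apply/eqP => sEM.
  have := sD 0; rewrite lexx ler01 => /(_ isT) p0.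
  have := slope0 (pE s); rewrite sEM /F => sl.
  have : 0 <= n.+1%:R * p s 0 by rewrite mulr_ge0.
  by rewrite sEM sl; have := f_large; lra.
suff [r0 r01 pr0] : exists2 r0, 0 <= r0 <= 1 & p s r0 = 0.
  by exists s; split; rewrite ?s_gt0//; exact: touching (ltW s_gt0) sD r01 pr0.
(* Without a zero, [p s] has a positive minimum on the compact interval, and Lipschitz dependence
   keeps [p d >= 0] for some [d > s], against the choice of [s]. *)
apply: contrapT => noz.
have [|c cI cmin] := @EVT_min R (p s) 0 1 ler01.
  by apply: continuous_subspaceT => x; exact: cp.
rewrite in_itv/= in cI.
have pc : 0 < p s c.
  rewrite lt_neqAle sD// andbT; apply/eqP => pc0; apply: noz; exists c => //.
have [y y0 Ky] := small _ pc.
pose d := Num.min (s + y) M.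
have sd : s < d by rewrite lt_min ltrDl y0.
have : d <= s.
  apply: ub_le_sup; first by case: supD.
  split; first by rewrite (le_trans dls (ltW sd)) ge_min lexx orbT.
  move=> r r01; have := p_dist s d r01.
  have := cmin r; rewrite in_itv/= => /(_ r01).
  rewrite [X in _ <= K * X -> _]ltr0_norm ?subr_lt0// opprB.
  have : K * (d - s) <= K * y.
    by rewrite ler_wpM2l// lerBlDl ge_min lexx.
  by rewrite ler_norml => ? ? /andP[? ?]; lra.
by rewrite leNgt sd.
Qed.

Theorem neumann_slope : exists d q, [/\ 0 < d <= M, continuous q,
  q = avg n (rhs F b d q), q 1 = 0 &
  forall r, 0 <= r <= 1 -> 0 <= q r /\ d <= profile d q r <= M * expR 1].
Proof.
have [d [/andP[d0 dM] pd p1]] := shooting.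
exists d, (p d); split => //; first by rewrite d0.
move=> r r01; split; first exact: pd.
rewrite profile_ge ?(ltW d0)//= (le_trans (profile_le (ltW d0) pd r01))//.
by rewrite ler_wpM2r// expR_ge0.
Qed.

End shooting.

(** * Truncation of the data *)

Section C1_facts.
Context {R : realType}.
Implicit Types (f df : R -> R) (A : set R) (x y r s t c d e u v : R).

Definition clamp u v x : R := Num.min (Num.max u x) v.

Lemma clamp_itv u v x : u <= v -> u <= clamp u v x <= v.
Proof. by move=> uv; rewrite /clamp le_min le_max lexx uv ge_min lexx orbT. Qed.

Lemma clamp_id u v x : u <= x <= v -> clamp u v x = x.
Proof. by move=> /andP[ux xv]; rewrite /clamp (max_idPr ux) (min_idPl xv). Qed.

Lemma clamp_homo u v x y : x <= y -> clamp u v x <= clamp u v y.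
Proof.
move=> xy; rewrite /clamp le_min !ge_min !ge_max !le_max xy !lexx/= !orbT !andbT.
by [].
Qed.

Lemma clamp_dist u v x y : `|clamp u v x - clamp u v y| <= `|x - y|.
Proof.
wlog xy : x y / x <= y.
  move=> W; have [xy|/ltW yx] := leP x y; first exact: W.
  by rewrite distrC [`|x - y|]distrC; exact: W.
rewrite distrC [`|x - y|]distrC !ger0_norm ?subr_ge0 ?clamp_homo//.
have ux : u <= Num.max u x by rewrite le_max lexx.
have xx : x <= Num.max u x by rewrite le_max lexx orbT.
have uy : Num.max u y <= Num.max u x + (y - x).
  by rewrite ge_max; apply/andP; split; lra.
rewrite lerBlDr addrC /clamp; have [m|m] := leP (Num.max u x) v.
  by rewrite ge_min uy.
by rewrite ge_min lerDl subr_ge0 xy orbT.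
Qed.

Lemma continuous_clamp f u v : u <= v -> {within `[u, v], continuous f} ->
  continuous (f \o clamp u v).
Proof.
move=> uv /subspace_continuousP cf x.
have cI y : clamp u v y \in `[u, v] by rewrite in_itv/= clamp_itv.
have /cvgrPdist_le {}cf := cf (clamp u v x) (cI x).
apply/cvgrPdist_le => e e0.
have [d /= d0 H] := cf e e0; exists d => // y /= xy.
apply: H; last exact: cI.
by rewrite /=; apply: le_lt_trans xy; exact: clamp_dist.
Qed.

(** Links the relative derivatives of [C1_on] with [is_derive] at interior points, through
    Caratheodory's form of the derivative. *)
Lemma difference_quotient_is_derive A f x c : nbhs x A ->
  (f y - f x) / (y - x) @[y --> within A x^'] --> c -> is_derive x 1 f c.
Proof.
move=> nA /cvgrPdist_le H; apply/is_derive1_caratheodory.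
exists (fun z => if z == x then c else (f z - f x) / (z - x)); split.
- move=> z; case: eqP => [->|/eqP]; first by rewrite !subrr mulr0.
  by rewrite -subr_eq0 => /divfK->.
- apply/cvgrPdist_le => e e0; rewrite eqxx.
  have := H e e0; rewrite !near_withinE => H'.
  near=> y; case: eqP => [_|/eqP yx]; first by rewrite subrr normr0 ltW.
  have : A y by near: y.
  by move: yx; near: y.
- by rewrite eqxx.
Unshelve. all: by end_near. Qed.

Lemma difference_quotient_within A f x c :
  (f y - f x) / (y - x) @[y --> within A x^'] --> c ->
  f y @[y --> within A (nbhs x)] --> f x.
Proof.
move=> /cvgrPdist_le /(_ 1 ltr01); rewrite !near_withinE => H.
apply/cvgrPdist_le => e e0; rewrite near_withinE.
have c1 : 0 < `|c| + 1 by rewrite ltr_wpDl.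
near=> y => Ay; have [->|yx] := eqVneq y x; first by rewrite subrr normr0 ltW.
have q : `|c - (f y - f x) / (y - x)| <= 1.
  by move: yx Ay; near: y.
have d : `|x - y| <= e / (`|c| + 1).
  near: y.
  have /cvgrPdist_le : (id : R -> R) y @[y --> x] --> x by exact: cvg_id.
  by apply; rewrite divr_gt0.
have yx0 : y - x != 0 by rewrite subr_eq0.
have q2 : `|(f y - f x) / (y - x)| <= `|c| + 1.
  rewrite -[X in `|X|](subKr c) (le_trans (ler_normB _ _))// lerD2l//.
rewrite distrC -[f y - f x](divfK yx0) normrM [`|y - x|]distrC.
apply: (le_trans (ler_pM _ _ q2 d)) => //.
by rewrite mulrC divfK// gt_eqF.
Unshelve. all: by end_near. Qed.

Lemma C1_on_within A f x : C1_on A f -> A x -> f y @[y --> within A (nbhs x)] --> f x.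
Proof. by move=> [df [_ H]] Ax; apply: difference_quotient_within (H x Ax). Qed.

Lemma C1_on_continuous A D f : C1_on A f -> D `<=` A -> {within D, continuous f}.
Proof.
move=> Cf DA; apply/subspace_continuousP => x Dx.
have := C1_on_within Cf (DA _ Dx); apply: cvg_trans; apply: cvg_app.
exact: within_subset.
Qed.

(** Mean value theorem with the maximum of [|df|] on [[u, v]]. The derivative is two-sided inside
    []s, t[], and the ends only need continuity. *)
Lemma C1_on_lipschitz f u v : u <= v -> C1_on `[u, +oo[ f ->
  exists2 L, 0 <= L &
    forall s t, u <= s <= v -> u <= t <= v -> `|f s - f t| <= L * `|s - t|.
Proof.
move=> uv Cf; have [df [cdf Hdf]] := Cf.
have sub : (`[u, v] : set R) `<=` `[u, +oo[.
  by move=> x /=; rewrite !in_itv/= => /andP[->].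
have cdf' : {within `[u, v], continuous (fun x => `|df x|)}.
  have /subspace_continuousP H := continuous_subspaceW sub cdf.
  by apply/subspace_continuousP => x xI; apply: cvg_norm; exact: H.
have [c cI cmax] := EVT_max uv cdf'.
exists `|df c| => // s t.
wlog st : s t / s <= t.
  move=> W sI tI; have [st|/ltW ts] := leP s t; first exact: W.
  by rewrite distrC [`|s - t|]distrC; exact: W.
move=> /andP[us sv] /andP[ut tv].
have der x : x \in `]s, t[ -> is_derive x 1 f (df x).
  rewrite in_itv/= => /andP[sx xt].
  apply: (@difference_quotient_is_derive `[u, +oo[).
    near=> y; rewrite /= in_itv/= andbT (le_trans us)// ltW//.
    by near: y; exact: lt_nbhsr.
  by apply: Hdf; rewrite /= in_itv/= andbT (le_trans us)// ltW.
have cst : {within `[s, t], continuous f}.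
  apply: (C1_on_continuous Cf) => x /=; rewrite !in_itv/= => /andP[sx xt].
  by rewrite andbT (le_trans us).
have [x xI E] := MVT_segment st der cst.
rewrite distrC [`|s - t|]distrC E normrM ler_wpM2r//.
apply: cmax; move: xI; rewrite !in_itv/= => /andP[sx xt].
by rewrite (le_trans us)//= (le_trans xt).
Unshelve. all: by end_near. Qed.

Lemma limf_einf_pinfty_gt (g : R -> R) c :
  (c%:E < limf_einf (fun s => (g s)%:E) (pinfty_nbhs R))%E ->
  exists2 x, 0 < x & c < g x.
Proof.
rewrite limf_einfE => /ereal_sup_gt[_ [V [x [_ xV]] <-]] cV.
pose y := Num.max x 0 + 1.
have xy : x < y by rewrite /y (le_lt_trans (_ : _ <= Num.max x 0)) ?ltrDl// le_max lexx.
exists y; first by rewrite /y (le_lt_trans (_ : _ <= Num.max x 0)) ?ltrDl// le_max lexx orbT.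
rewrite -lte_fin; apply: (lt_le_trans cV); apply: ereal_inf_lbound.
by exists y => //; exact: xV.
Qed.

End C1_facts.

(** * The radial profile for the original coefficients *)

Section radial_profile.
Context {R : realType}.
Implicit Types (a b f W p G : R -> R) (x y r s t c d e : R).

Lemma segment_bounded (g : R -> R) : {within `[0, 1], continuous g} ->
  exists A, forall r, `|(g \o clamp 0 1) r| <= A.
Proof.
move=> /subspace_continuousP cg.
have cg' : {within `[0, 1], continuous (fun x => `|g x|)}.
  by apply/subspace_continuousP => x xI; apply: cvg_norm; exact: cg.
have [c cI cmax] := EVT_max ler01 cg'.
by exists `|g c| => r; apply: cmax; rewrite in_itv/= clamp_itv.
Qed.

Theorem radial_profile (n : nat) a b f
  (a_C1 : C1_on `[0, 1] a)
  (a_homo : {in `[0, 1] &, {homo a : r s / r <= s}})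
  (a0_gt0 : 0 < a 0)
  (b_cont : {within `[0, 1], continuous b})
  (b_le0 : forall r, r \in `[0, 1] -> b r <= 0)
  (f_C1 : C1_on `[0, +oo[ f)
  (f_homo : {in `[0, +oo[ &, {homo f : s t / s <= t}})
  (f_0 : f 0 = 0)
  (f_deriv0 : f s / s @[s --> 0^'+] --> 0)
  (f_liminf : ((a 0)^-1%:E < limf_einf (fun s => (f s / s)%:E) (pinfty_nbhs R))%E) :
  exists d W p G, [/\ 0 < d, continuous p, continuous G, p 1 = 0 &
    [/\ n.+1%:R * p 0 = G 0,
     forall r, 0 <= r -> is_derive r 1 W (r * p r),
     forall r, 0 < r -> is_derive r 1 p ((G r - n.+1%:R * p r) / r) &
     forall r, 0 <= r <= 1 -> [/\ 0 <= p r, d <= W r &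
       G r = W r - a r * f (W r) + b r * r ^+ 2 * p r]]].
Proof.
have a01 : 0 < a 1.
  by apply: lt_le_trans a0_gt0 _; apply: a_homo; rewrite ?in_itv/= ?lexx ?ler01.
have [M M_gt0 fM] := limf_einf_pinfty_gt f_liminf.
have {}fM : M < a 0 * f M.
  by move: fM; rewrite ltr_pdivlMr// mulrC ltr_pdivrMr// mulrC.
have ia : 0 < (a 1)^-1 by rewrite invr_gt0.
have [s1 s1_gt0 fs1] : exists2 s1, 0 < s1 & forall s, 0 < s <= s1 -> a 1 * f s < s.
  have /cvgrPdist_lt /(_ _ ia) [e /= e0 H] := f_deriv0.
  exists (e / 2); first by rewrite divr_gt0.
  move=> s /andP[s0 se].
  have := H s; rewrite /= sub0r normrN gtr0_norm// => /(_ _ s0).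
  rewrite sub0r normrN => H'; rewrite mulrC -ltr_pdivlMr//.
  have : f s / s < (a 1)^-1.
    apply: le_lt_trans (ler_norm _) (H' _).
    by rewrite (le_lt_trans se)// ltr_pdivrMr// ltr_pMr// ltr1n.
  by rewrite ltr_pdivrMr// mulrC.
(* The upper bound for the profile found by shooting: on [[0, K]] the truncated [fc] agrees with
   [f]. *)
pose K := M * expR 1.
have e1 : 1 <= expR 1 :> R by rewrite -[leLHS]expR0 ler_expR ler01.
have MK : M <= K by rewrite /K ler_peMr// ltW.
have K0 : 0 <= K by rewrite (le_trans (ltW M_gt0)).
have [L L0 fL] := C1_on_lipschitz K0 f_C1.
pose ac := a \o clamp 0 1; pose bc := b \o clamp 0 1; pose fc := f \o clamp 0 K.
have a_cont : {within `[0, 1], continuous a} by exact: C1_on_continuous a_C1 _.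
have cac : continuous ac by exact: continuous_clamp.
have cbc : continuous bc by exact: continuous_clamp.
have [A aA] := segment_bounded a_cont.
have [B bB] := segment_bounded b_cont.
have c01 r : 0 <= r <= 1 -> clamp 0 1 r = r by exact: clamp_id.
have cI r : clamp 0 1 r \in `[0, 1 : R] by rewrite in_itv/= clamp_itv.
have cK s : clamp 0 K s \in `[0, +oo[.
  by rewrite in_itv/= andbT; case/andP: (clamp_itv s K0).
have fcK s : 0 <= s <= K -> fc s = f s by move=> H; rewrite /fc /= clamp_id.
have fc_lip s t : `|fc s - fc t| <= L * `|s - t|.
  apply: (le_trans (fL _ _ (clamp_itv _ K0) (clamp_itv _ K0))).
  by rewrite ler_wpM2l// clamp_dist.
have fc_homo s t : 0 <= s -> s <= t -> fc s <= fc t.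
  by move=> _ st; apply: f_homo => //; exact: clamp_homo.
have fc0 : fc 0 = 0 by rewrite fcK ?lexx ?K0.
have ac0 : ac 0 = a 0 by rewrite /ac /= c01 ?lexx ?ler01.
have ac1 : ac 1 = a 1 by rewrite /ac /= c01 ?lexx ?ler01.
have ac_homo r s : 0 <= r -> r <= s -> s <= 1 -> ac r <= ac s.
  by move=> _ rs _; apply: a_homo => //; exact: clamp_homo.
have bc_le0 r : 0 <= r <= 1 -> bc r <= 0 by move=> _; exact: b_le0.
pose s0 := Num.min s1 K.
have s0_gt0 : 0 < s0 by rewrite lt_min s1_gt0 (lt_le_trans M_gt0).
have fc_small s : 0 < s <= s0 -> ac 1 * fc s < s.
  rewrite le_min => /and3P[sp ss1 sK]; rewrite ac1 fcK ?(ltW sp)//.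
  by apply: fs1; rewrite sp.
have fc_large : M < ac 0 * fc M by rewrite ac0 fcK// (ltW M_gt0).
have aA0 : 0 < ac 0 by rewrite ac0.
have [d [p [/andP[d0 dM] cp pE p1 pb]]] := @neumann_slope R n ac bc fc A B L M s0
  cac cbc aA bB aA0 ac_homo bc_le0 L0 fc_lip fc_homo fc0 s0_gt0 fc_small M_gt0 fc_large.
have cF := continuous_reaction cac L0 fc_lip.
(* [W] is the profile without the absolute value, which makes the derivative formula valid at
   [r = 0] as well. *)
exists d, (fun r => d + prim (fun s => s * p s) r), p, (rhs (reaction ac fc) bc d p).
have cG := continuous_rhs cF cbc cp.
split => //; split.
- by rewrite (slope0 pE) -{1}(profile0 d p) /rhs expr0n/= mulr0 mul0r addr0.
- move=> r r0; have r1 : -1 < r by apply: lt_le_trans r0; rewrite ltrN10.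
  have dP := is_derive_prim (continuous_idM cp) r1.
  by rewrite -[r * p r]add0r; exact: is_deriveD.
- by move=> r r0; exact: (is_derive_slope cF).
- move=> r r01; have [pr /andP[ur uK]] := pb r r01.
  have rE : prim (fun s => s * p s) r = prim (fun s => s * p s) `|r|.
    by case/andP: r01 => r0 _; rewrite ger0_norm.
  rewrite rE; split => //.
  rewrite /rhs /reaction -/(profile d p r) /ac /bc /= c01// fcK//.
  by rewrite (le_trans (ltW d0)).
Qed.

End radial_profile.

(** * Borel sets and Lebesgue measure on row vectors *)

Section borel_rV.
Context {R : realType} {n : nat}.
Local Notation V := 'rV[R]_n.
Implicit Types (u : V -> R) (x y : V) (e : R).

Lemma measurable_rV_ball x e : measurable (ball x e : set V).
Proof.
have [e0|e0] := ltP 0 e; last first.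
  rewrite (_ : ball x e = set0) // -subset0 => y [] /=.
  by rewrite ltNge e0.
rewrite (_ : ball x e = \bigcap_(i in [set: 'I_n])
    ((fun v : V => v ord0 i) @^-1` ball (x ord0 i) e)); last first.
  apply/seteqP; split => [y [_ H] i _|y H]; first exact: H.
  by split=> // i j; rewrite (ord1 i); exact: H.
apply: fin_bigcap_measurable; first exact: finite_finset.
move=> i _; rewrite -[X in measurable X]setTI; apply: measurable_coord => //.
exact: measurable_ball.
Qed.

(** The sigma-algebra is generated by coordinates, so [U] is written as the countable union of the
    balls with rational centre and radius [1 / (k + 1)] that it contains. *)
Lemma open_measurable_rV (U : set V) : open U -> measurable U.
Proof.
move=> oU.
pose F (qk : 'rV[rat]_n * nat) : set V :=
  let B := ball (map_mx ratr qk.1 : V) (qk.2.+1%:R^-1 : R) in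
  if `[< B `<=` U >] then B else set0.
rewrite (_ : U = \bigcup_qk F qk).
  apply: countable_bigcupT_measurable => // -[q k]; rewrite /F.
  by case: ifP => // _; exact: measurable_rV_ball.
apply/seteqP; split => [x Ux|x [[q k] _]]; last first.
  by rewrite /F; case: ifPn => // /asboolP; exact.
have /nbhs_ballP[e /= e0 xeU] : nbhs x U by exact: open_nbhs_nbhs.
have [k ke] : exists k, k.+1%:R^-1 < e / 2.
  exists (Num.bound (e / 2)^-1); rewrite invf_plt ?posrE ?divr_gt0//.
  have /archi_boundP/lt_le_trans : 0 <= (e / 2)^-1 by rewrite invr_ge0 divr_ge0 ?ltW.
  by apply; rewrite ler_nat.
pose d : R := k.+1%:R^-1.
have d0 : 0 < d by rewrite invr_gt0.
have Q i : exists q, ball (x ord0 i) d (ratr q).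
  have [r [Br [q _ qr]]] :=
    dense_rat (ex_intro _ _ (ballxx (x ord0 i) d0)) (@ball_open _ _ (x ord0 i) d).
  by exists q; rewrite qr.
have [q Hq] := choice Q.
have xq : ball x d (map_mx ratr (\row_i q i) : V).
  by split => // i j; rewrite (ord1 i) !mxE; exact: Hq.
exists (\row_i q i, k) => //; rewrite /F /=.
have sub : ball (map_mx ratr (\row_i q i) : V) d `<=` U.
  move=> y qy; apply: xeU.
  by apply: (le_ball _ (ball_triangle xq qy)); rewrite [leRHS]splitr lerD// ltW.
rewrite ifT; last exact/asboolP.
exact: ball_sym.
Qed.

Lemma continuous_measurable_rV u : continuous u -> measurable_fun [set: V] u.
Proof.
move=> /continuousP cu; apply: (measurability _ (RGenOpens.measurableE R)).
move=> _ [_ [a [b ->] <-]]; rewrite setTI.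
by apply: open_measurable_rV; exact/cu/interval_open.
Qed.

End borel_rV.

Section box.
Context {R : realType}.
Local Open Scope ereal_scope.

(** Balls of the sup norm are cubes. This gives both the finiteness of the volume of the unit ball
    and the positivity of the measure on nonempty open sets. *)
Lemma lebesgue_rV_ball n (x : 'rV[R]_n) (e : R) : (0 < e)%R ->
  lebesgue_rV n (ball x e) = (e *+ 2)%:E ^+ n.
Proof.
move=> e0; elim: n x => [|n IH] x.
  by rewrite expe0 /= diracE mem_set//; split => // i [].
rewrite expeS /= /lebesgue_rV_step /pushforward.
rewrite (_ : _ @^-1` _ = ball (x ord0 ord0) e `*`
   ball (\row_i x ord0 (lift ord0 i)) e); last first.
  apply/seteqP; split => -[t v] /=.
    move=> [_ H]; split.
      by have := H ord0 ord0; rewrite mxE unlift_none.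
    split => // i j; rewrite (ord1 i) mxE.
    by have := H ord0 (lift ord0 j); rewrite mxE liftK.
  move=> [Ht [_ Hv]]; split => // i j; rewrite (ord1 i) mxE.
  case: unliftP => [k ->|->] //=.
  by have := Hv ord0 k; rewrite mxE.
rewrite product_measure1E//; last exact: measurable_rV_ball.
  rewrite IH; congr (_ * _); exact: (lebesgue_measure_ball _ (ltW e0)).
exact: measurable_ball.
Qed.

End box.

(** * Integration by parts *)

(** A directional derivative depends only on the restriction to a line. This allows coordinates to
    be frozen and reduces partial derivatives to derivatives in one variable. *)
Lemma is_derive_line (R : realType) (V W : normedModType R)
    (f : V -> R) (g : W -> R) (x v : V) (y w : W) (l : R) :
  (forall h : R, f (h *: v + x) = g (h *: w + y)) ->
  is_derive x v f l -> is_derive y w g l.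
Proof.
move=> fg [df fE].
have fg0 : f x = g y by have := fg 0; rewrite !scale0r !add0r.
have E : (fun h : R => h^-1 *: ((f \o shift x) (h *: v) - f x)) =
         (fun h : R => h^-1 *: ((g \o shift y) (h *: w) - g y)).
  by apply/funext => h /=; rewrite fg fg0.
by apply: DeriveDef; rewrite /derivable /derive -E.
Qed.

Lemma integrable_bounded_support (d : measure_display) (T : measurableType d)
    (R : realType) (mu : {measure set T -> \bar R}) (A : set T) (g : T -> R) (C : R) :
  measurable A -> (mu A < +oo)%E -> measurable_fun [set: T] g ->
  (forall x, A x -> `|g x| <= C) -> (forall x, ~ A x -> g x = 0) ->
  mu.-integrable [set: T] (EFin \o g).
Proof.
move=> mA muA mg gC gA.
have <- : (EFin \o g) \_ A = EFin \o g.
  apply/funext => x; rewrite patchE; case: ifPn => // /negP; rewrite inE => /gA /= ->.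
  by [].
apply/integrable_restrict => //; rewrite setTI.
apply: measurable_bounded_integrable => //; first exact: measurable_funTS.
exists C; split; first by rewrite num_real.
by move=> M CM x /= Ax; rewrite (le_trans (gC x Ax))// ltW.
Qed.

Section zero_integral.
Context {R : realType}.

Lemma continuous_box_bounded n (u : 'rV[R]_n -> R) : continuous u ->
  exists C, forall x : 'rV[R]_n, (forall j, `|x ord0 j| <= 1) -> `|u x| <= C.
Proof.
move=> cu.
pose K : set 'rV[R]_n :=
  [set v | forall i, (`[-1, 1]%classic : set R) (v ord0 i)].
have cK : compact K.
  have := @rV_compact R n (fun=> (`[-1, 1]%classic : set R)); apply => _.
  exact: segment_compact.
have K0 : K !=set0.
  by exists 0 => i; rewrite /= mxE in_itv/= lerN10 ler01.
have cn : continuous ((fun r : R => `|r|) \o u).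
  by move=> x; apply: continuous_comp; [exact: cu|exact: norm_continuous].
have cu' : {within K, continuous (fun x => `|u x|)} by exact: continuous_subspaceT.
have [c _ cmax] := EVT_max_rV K0 cK cu'.
exists `|u c| => x Hx; apply: cmax; rewrite inE => i /=.
by rewrite in_itv/= -ler_norml.
Qed.

Lemma rV_cons_line0 n (t h : R) (v : 'rV[R]_n) :
  rV_cons (h * 1 + t, v) = h *: delta_mx ord0 ord0 + rV_cons (t, v).
Proof.
apply/rowP => k; rewrite !mxE /=; case: unliftP => [j ->|->] /=.
  by rewrite mulr0 add0r.
by [].
Qed.

Lemma rV_cons_line n (t h : R) (v : 'rV[R]_n) (j : 'I_n) :
  rV_cons (t, h *: delta_mx ord0 j + v) =
  h *: delta_mx ord0 (lift ord0 j) + rV_cons (t, v).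
Proof.
apply/rowP => k; rewrite !mxE /=; case: unliftP => [i ->|->] /=.
  by rewrite !mxE (inj_eq lift_inj).
by rewrite mulr0 add0r.
Qed.

Lemma continuous_rV_cons n (v : 'rV[R]_n) : continuous (fun t : R => rV_cons (t, v)).
Proof.
move=> t; apply/cvg_ballP => e e0.
have : \forall s \near t, ball t e s by exact: nbhsx_ballx.
apply: filterS => s ts; split=> // i j; rewrite (ord1 i) !mxE.
by case: unliftP => [k _|_] /=; [exact: ballxx|exact: ts].
Qed.

Lemma continuous_rV_consr n (t : R) : continuous (fun v : 'rV[R]_n => rV_cons (t, v)).
Proof.
move=> v U /nbhs_ballP[e /= e0 eU]; apply/nbhs_ballP; exists e => // w [_ vw].
apply: eU; split=> // i j; rewrite (ord1 i) !mxE.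
by case: unliftP => [k _|_] /=; [exact: vw|exact: ballxx].
Qed.

Lemma integral_lebesgue_rVS n (u : 'rV[R]_n.+1 -> R) : continuous u ->
  (lebesgue_measure \x lebesgue_rV n)%E.-integrable [set: _]
    (EFin \o (fun p => u (rV_cons p))) ->
  (\int[lebesgue_rV n.+1]_x (u x)%:E =
   \int[lebesgue_measure \x lebesgue_rV n]_p (u (rV_cons p))%:E)%E.
Proof.
move=> cu iu; rewrite /= /lebesgue_rV_step.
rewrite (integral_pushforward (@measurable_rV_cons R n)).
- by rewrite preimage_setT.
- by apply/measurable_EFinP; exact: continuous_measurable_rV.
- by rewrite preimage_setT.
- exact: measurableT.
Qed.

(** Fubini and induction on the dimension: for [i] other than the first coordinate, the inner
    integral over the remaining ones vanishes by induction; for the first, integrate along it and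
    apply the fundamental theorem of calculus. *)
Lemma integral_derivative_eq0 n (i : 'I_n) (psi chi : 'rV[R]_n -> R) :
  continuous chi ->
  (forall x, is_derive x (delta_mx ord0 i) psi (chi x)) ->
  (forall (x : 'rV[R]_n) j, 1 <= `|x ord0 j| -> psi x = 0 /\ chi x = 0) ->
  (\int[lebesgue_rV n]_x (chi x)%:E = 0)%E.
Proof.
elim: n i psi chi => [[]//|n IH] i psi chi cchi dpsi supp.
have [C chiC] := continuous_box_bounded cchi.
pose g (p : measurableTypeR R * 'rV[R]_n) := chi (rV_cons p).
have mg : measurable_fun [set: _] g.
  by apply: measurableT_comp; [exact: continuous_measurable_rV|exact: measurable_rV_cons].
pose A : set (measurableTypeR R * 'rV[R]_n) := ball (0 : R) 1 `*` ball (0 : 'rV[R]_n) 1.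
have ig : (lebesgue_measure \x lebesgue_rV n)%E.-integrable [set: _] (EFin \o g).
  apply: (@integrable_bounded_support _ _ _ _ A g C) => //.
  - by apply: measurableX; [exact: measurable_ball|exact: measurable_rV_ball].
  - rewrite /A [X in (X < _)%E](product_measure1E lebesgue_measure (lebesgue_rV n)).
    + rewrite lebesgue_rV_ball// [X in (X * _ < _)%E](lebesgue_measure_ball _ ler01).
      by rewrite -EFin_expe -EFinM ltry.
    + exact: measurable_ball.
    + exact: measurable_rV_ball.
  - move=> [t v] [/= Ht [_ Hv]]; apply: chiC => j; rewrite mxE.
    case: unliftP => [k _|_] /=.
      by have := Hv ord0 k; rewrite /ball/= mxE sub0r normrN => /ltW.
    by move: Ht; rewrite /ball/= sub0r normrN => /ltW.
  - move=> [t v] H; apply: contrapT => gn0; apply: H; split => /=.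
      rewrite /ball/= sub0r normrN ltNge; apply/negP => t1; apply: gn0.
      by apply: (supp _ ord0 _).2; rewrite mxE unlift_none.
    split => // i' j; rewrite (ord1 i') /ball/= mxE sub0r normrN ltNge.
    apply/negP => t1; apply: gn0.
    by apply: (supp _ (lift ord0 j) _).2; rewrite mxE liftK.
have [j ij|i0] := unliftP ord0 i.
  have := integral12_prod_meas1 ig; rewrite integral0_eq => [/esym E12|t _].
    exact: etrans (integral_lebesgue_rVS cchi ig) E12.
  rewrite /fubini_F; apply: (IH j (fun v => psi (rV_cons (t, v)))).
  - by move=> v; apply: (@continuous_comp _ _ _ (fun v : 'rV[R]_n => rV_cons (t, v)) chi);
      [exact: continuous_rV_consr|exact: cchi].
  - move=> v; apply: (is_derive_line _ (dpsi (rV_cons (t, v)))) => h.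
    by rewrite rV_cons_line -ij.
  - by move=> v k vk; apply: (supp _ (lift ord0 k)); rewrite mxE liftK.
have := integral21_prod_meas1 ig; rewrite integral0_eq => [/esym E21|v _].
  exact: etrans (integral_lebesgue_rVS cchi ig) E21.
rewrite /fubini_G.
pose F (t : R) := psi (rV_cons (t, v)); pose G (t : R) := chi (rV_cons (t, v)).
have cG : continuous G.
  by move=> t; apply: (@continuous_comp _ _ _ (fun t : R => rV_cons (t, v)) chi);
    [exact: continuous_rV_cons|exact: cchi].
have dF (t : R) : is_derive t 1 F (G t).
  apply: (is_derive_line _ (dpsi (rV_cons (t, v)))) => h.
  by rewrite i0 -rV_cons_line0.
have FG0 (t : R) : 1 <= `|t| -> F t = 0 /\ G t = 0.
  by move=> t1; apply: (supp _ ord0); rewrite mxE unlift_none.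
have cF (t : R) : {for t, continuous F} by exact: is_derive1_continuous (dF t).
(* [G] vanishes off [[-1, 1]], and its primitive [F] vanishes at both ends. *)
transitivity (\int[lebesgue_measure]_(t in `[(-1)%R, 1%R]) (G t)%:E)%E.
  rewrite [RHS]integral_mkcond; apply: eq_integral => t _; rewrite patchE.
  case: ifPn => //; rewrite notin_setE /= in_itv/= => /negP tI.
  have t1 : 1 <= `|t| by rewrite leNgt; apply/negP => /ltW; rewrite ler_norml (negbTE tI).
  by have [_ Gt] := FG0 t t1; rewrite /= /g -/(G t) Gt.
rewrite (@continuous_FTC2 R G F) ?ltrN10 //.
- have [|-> _] := FG0 1; first by rewrite normr1.
  by have [|-> _] := FG0 (-1); rewrite ?normrN1// subee.
- exact: continuous_subspaceT.
- split.
  + by move=> t _; have [] := dF t.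
  + by apply: cvg_at_right_filter; exact: cF.
  + by apply: cvg_at_left_filter; exact: cF.
- by move=> t _; rewrite derive1E; have [] := dF t.
Qed.

End zero_integral.

(** * Classical functions in H^2 of the ball *)

Lemma continuous_mul (R : realType) (T : topologicalType) (f g : T -> R) :
  continuous f -> continuous g -> continuous (fun x => f x * g x).
Proof. by move=> cf cg x; apply: cvgM; [exact: cf|exact: cg]. Qed.

Lemma continuous_add (R : realType) (T : topologicalType) (f g : T -> R) :
  continuous f -> continuous g -> continuous (fun x => f x + g x).
Proof. by move=> cf cg x; apply: cvgD; [exact: cf|exact: cg]. Qed.

Section L2_facts.
Context {R : realType}.

Lemma L2_bounded n (mu : {measure set 'rV[R]_n -> \bar R}) (D : set 'rV[R]_n)
    (u : 'rV[R]_n -> R) (C : R) :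
  measurable D -> (mu D < +oo)%E -> measurable_fun [set: 'rV[R]_n] u ->
  (forall x, D x -> `|u x| <= C) -> L2 mu D u.
Proof.
move=> mD muD mu_ uC.
have mr : measurable_fun [set: 'rV[R]_n] (u \_ D).
  by apply: (measurable_restrictT u mD).1; exact: measurable_funS mu_.
apply/andP; split; first by rewrite inE.
rewrite inE/= /finite_norm unlock /Lnorm; apply: poweR_lty.
have C2 x : D x -> `| `|(u \_ D) x| `^ 2 | <= `|C| `^ 2.
  move=> Dx; rewrite ger0_norm ?powR_ge0// ge0_ler_powR ?nnegrE//.
  by rewrite patchE ifT ?inE// (le_trans (uC x Dx)) ?ler_norm.
have C0 x : ~ D x -> `|(u \_ D) x| `^ 2 = 0.
  by move=> Dx; rewrite patchE ifF ?normr0 ?powR0//; apply/negP; rewrite inE.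
have m2 : measurable_fun [set: 'rV[R]_n] (fun x => `|(u \_ D) x| `^ 2).
  by apply: (measurableT_comp (measurable_powR 2)); exact: measurableT_comp.
have /integrableP[_] := integrable_bounded_support mD muD m2 C2 C0.
apply: le_lt_trans; rewrite le_eqVlt; apply/orP; left; apply/eqP.
by apply: eq_integral => x _ /=; congr EFin; rewrite [RHS]ger0_norm// powR_ge0.
Qed.

Lemma L2_cvg_cst n (mu : {measure set 'rV[R]_n -> \bar R}) (D : set 'rV[R]_n)
  (u : 'rV[R]_n -> R) : L2_cvg mu D (fun=> u) u.
Proof.
rewrite /L2_cvg.
rewrite (_ : (fun _ => _) = cst 0%E); first exact: cvg_cst.
apply/funext => k; rewrite (_ : EFin \o _ = cst 0%E); last first.
  by apply/funext => x; rewrite /= patchE /= subrr; case: ifP.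
by rewrite Lnorm0// gt_eqF// lte_fin.
Qed.

End L2_facts.

Section ball_facts.
Context {R : realType} {n : nat}.
Implicit Types (x : 'rV[R]_n) (u phi : 'rV[R]_n -> R).
Local Notation leb := (lebesgue_rV n : {measure set 'rV[R]_n -> \bar R}).
Local Notation B := (@unit_ball R n).
Local Notation S := (@unit_sphere R n).

Lemma enorm_ge0 x : 0 <= enorm x.
Proof. exact: sqrtr_ge0. Qed.

Lemma sum_sqr_ge0 x : 0 <= \sum_i x ord0 i ^+ 2.
Proof. by apply: sumr_ge0 => i _; exact: sqr_ge0. Qed.

Lemma sqr_enorm x : enorm x ^+ 2 = \sum_i x ord0 i ^+ 2.
Proof. by rewrite sqr_sqrtr// sum_sqr_ge0. Qed.

Lemma coord_le_enorm x j : `|x ord0 j| <= enorm x.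
Proof.
rewrite -(@ler_pXn2r _ 2) ?nnegrE ?enorm_ge0// real_normK ?num_real// sqr_enorm.
by rewrite (bigD1 j)//= lerDl sumr_ge0// => i _; exact: sqr_ge0.
Qed.

Lemma continuous_enorm : continuous (@enorm R n).
Proof.
have cs : continuous (fun y : 'rV[R]_n => \sum_i y ord0 i ^+ 2).
  apply: continuous_big => [|i _]; first exact: add_continuous.
  move=> x; apply: (@continuous_comp _ _ _ (fun y : 'rV[R]_n => y ord0 i)
    (fun r : R => r ^+ 2)); [exact: coord_continuous|exact: exprn_continuous].
move=> x; apply: (@continuous_comp _ _ _ (fun y : 'rV[R]_n => \sum_i y ord0 i ^+ 2)
  Num.sqrt); [exact: cs|exact: sqrt_continuous].
Qed.

Lemma lebesgue_unit_ball_lty : (leb B < +oo)%E.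
Proof.
apply: (@le_lt_trans _ _ (leb (ball (0 : 'rV[R]_n) 1))).
  apply: le_measure; rewrite ?inE; [exact: measurable_unit_ball|exact: measurable_rV_ball|].
  move=> x /= Bx; split => // i j; rewrite (ord1 i) /ball/= mxE sub0r normrN.
  exact: le_lt_trans (coord_le_enorm x j) Bx.
by rewrite /= lebesgue_rV_ball// -EFin_expe ltry.
Qed.

Lemma measurable_unit_sphere : measurable S.
Proof.
rewrite -[X in measurable X]setTI.
exact: (measurable_enorm measurableT (measurable_set1 1)).
Qed.

Lemma sphere_measure_lty (A : set 'rV[R]_n) : measurable A ->
  ((sphere_measure : {measure set 'rV[R]_n -> \bar R}) A < +oo)%E.
Proof.
move=> mA; rewrite /sphere_measure /= /mscale/= /cone_measure/= /pushforward /mrestr.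
apply: lte_mul_pinfty => //; apply: le_lt_trans lebesgue_unit_ball_lty.
apply: le_measure; rewrite ?inE; last exact: subIsetr.
  apply: measurableI; last exact: measurable_unit_ball.
  by rewrite -[X in measurable X]setTI; exact: measurable_radial_proj.
exact: measurable_unit_ball.
Qed.

Lemma continuous_closed_ball_bounded u : continuous u ->
  exists C, forall x, enorm x <= 1 -> `|u x| <= C.
Proof.
move=> /continuous_box_bounded[C uC]; exists C => x x1; apply: uC => j.
exact: le_trans (coord_le_enorm x j) x1.
Qed.

Lemma continuous_L2 u : continuous u -> L2 leb B u.
Proof.
move=> cu; have [C uC] := continuous_closed_ball_bounded cu.
apply: (@L2_bounded _ _ _ _ _ C); [exact: measurable_unit_ball|
  exact: lebesgue_unit_ball_lty|exact: continuous_measurable_rV|].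
by move=> x Bx; apply: uC; exact: ltW.
Qed.

Lemma continuous_L2_sphere u : continuous u -> L2 sphere_measure S u.
Proof.
move=> cu; have [C uC] := continuous_closed_ball_bounded cu.
apply: (@L2_bounded _ _ _ _ _ C); [exact: measurable_unit_sphere|
  apply: sphere_measure_lty; exact: measurable_unit_sphere|exact: continuous_measurable_rV|].
by move=> x Sx; apply: uC; rewrite Sx.
Qed.

Lemma continuous_ball_integrable u : continuous u -> leb.-integrable B (EFin \o u).
Proof.
move=> cu; have [C uC] := continuous_closed_ball_bounded cu.
apply: measurable_bounded_integrable; [exact: measurable_unit_ball|
  exact: lebesgue_unit_ball_lty|apply: measurable_funTS; exact: continuous_measurable_rV|].
exists C; split; first by rewrite num_real.
by move=> M CM x /= Bx; rewrite (le_trans (uC x (ltW Bx)))// ltW.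
Qed.

(** The derivative of [u * phi] has zero integral: its support lies in the ball, hence in the cube,
    and the integral over the ball is the one over the whole space. *)
Lemma classical_weak_partial (i : 'I_n) (u du : 'rV[R]_n -> R) :
  continuous u -> continuous du ->
  (forall x, is_derive x (delta_mx ord0 i) u (du x)) -> weak_partial B i u du.
Proof.
move=> cu cdu dE phi [Cphi [K [cK KB phi0]]].
have [cphi /(_ i) [dphi [cdphi _]]] := Cphi 1%N.
pose psi x := u x * phi x.
pose chi x := u x * partial i phi x + du x * phi x.
have c1 : continuous (fun x => u x * partial i phi x).
  exact: continuous_mul.
have c2 : continuous (fun x => du x * phi x).
  exact: continuous_mul.
have cchi : continuous chi by exact: continuous_add.
have clK : open (~` K).
  by apply: closed_openC; apply: compact_closed cK; exact: norm_hausdorff.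
(* The complement of the compact [K] is open, so [phi] vanishes in a neighbourhood of [x]. *)
have dphi0 x : ~ K x -> partial i phi x = 0.
  move=> Kx.
  have : is_derive x (delta_mx ord0 i) phi 0.
    apply: (near_eq_is_derive _ (is_derive_cst (0 : R) x _)).
    have : \forall y \near x, (~` K) y by exact: open_nbhs_nbhs.
    by apply: filterS => y /phi0 ->.
  by case.
have dpsi x : is_derive x (delta_mx ord0 i) psi (chi x).
  have d1 := derivableP (dphi x).
  apply: (is_derive_eq (is_deriveM (dE x) d1)).
  by rewrite /chi /GRing.scale/= [phi x * _]mulrC.
have supp x : ~ B x -> psi x = 0 /\ chi x = 0.
  move=> Bx; have Kx : ~ K x by move/KB.
  by rewrite /psi /chi phi0// dphi0// !mulr0 addr0.
have int0 : (\int[lebesgue_rV n]_x (chi x)%:E = 0)%E.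
  apply: (integral_derivative_eq0 cchi dpsi) => x j xj; apply: supp => /= Bx.
  have := le_lt_trans (coord_le_enorm x j) Bx.
  by rewrite ltNge xj.
have intB : \int[leb]_(x in B) chi x = 0.
  rewrite Rintegral_mkcond (_ : chi \_ B = chi); last first.
    apply/funext => x; rewrite patchE; case: ifPn => // /negP; rewrite inE => /supp[_ ->].
    by [].
  by rewrite /Rintegral int0.
apply/eqP; rewrite -addr_eq0; apply/eqP.
rewrite -RintegralD//; [exact: measurable_unit_ball|
  exact: continuous_ball_integrable|exact: continuous_ball_integrable].
Qed.

Lemma classical_H1 u (du : 'I_n -> 'rV[R]_n -> R) :
  continuous u -> (forall i, continuous (du i)) ->
  (forall i x, is_derive x (delta_mx ord0 i) u (du i x)) -> H1 B u du.
Proof.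
move=> cu cdu dE; split; first exact: continuous_L2.
move=> i; split; first by apply: continuous_L2; exact: cdu.
by apply: classical_weak_partial => //; exact: cdu.
Qed.

(** The constant sequence [u] is already an admissible approximation. *)
Lemma classical_trace u du :
  continuous u -> H1 B u du -> trace u du u.
Proof.
move=> cu Hu; split; first exact: continuous_L2_sphere.
exists (fun=> u), (fun=> du); split => //.
- by move=> _; split => //; exact: continuous_subspaceT.
- exact: L2_cvg_cst.
- by move=> i; exact: L2_cvg_cst.
- exact: L2_cvg_cst.
Qed.

End ball_facts.

(** * Radial functions *)

Lemma is_derive1_chain (R : realType) (f g : R -> R) (x y l c : R) :
  is_derive x 1 g c -> g x = y -> is_derive y 1 f l ->
  is_derive x 1 (fun z => f (g z)) (l * c).
Proof.
move=> dg <- df; apply: (is_derive_eq (is_derive1_comp df dg)).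
by rewrite /GRing.scale/=.
Qed.

Lemma continuous_at_quotient (R : realType) (T : topologicalType)
    (f g h k : T -> R) (z : T) :
  {for z, continuous f} -> {for z, continuous g} -> {for z, continuous h} ->
  {for z, continuous k} -> k z ^+ 2 != 0 ->
  {for z, continuous (fun w => f w * (g w * h w / k w ^+ 2))}.
Proof.
move=> cf cg ch ck kz; apply: cvgM; first exact: cf.
apply: cvgM; first by apply: cvgM; [exact: cg|exact: ch].
apply: cvgV => //.
apply: (@continuous_comp _ _ _ k (fun r : R => r ^+ 2)) => //.
exact: exprn_continuous.
Qed.

Lemma continuous_at_dominated (R : realType) (T : topologicalType)
    (f g : T -> R) (z : T) : (forall w, `|f w| <= `|g w|) ->
  {for z, continuous g} -> f z = 0 -> g z = 0 -> {for z, continuous f}.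
Proof.
move=> fg cg fz gz; suff : f w @[w --> z] --> (0 : R) by rewrite -fz.
apply/cvgrPdist_le => e e0.
have /cvgrPdist_le /(_ e e0) := cg.
rewrite /= gz; apply: filterS => w; rewrite !sub0r !normrN => H.
exact: le_trans (fg w) H.
Qed.

Section radial_functions.
Context {R : realType} {n : nat}.
Local Notation V := 'rV[R]_n.
Implicit Types (x y : V) (W p q G : R -> R).

Lemma enorm_line x (j : 'I_n) (h : R) :
  enorm (h *: delta_mx ord0 j + x) = Num.sqrt (enorm x ^+ 2 + 2 * h * x ord0 j + h ^+ 2).
Proof.
rewrite sqr_enorm /enorm; congr Num.sqrt.
rewrite (bigD1 j)//= [in RHS](bigD1 j)//= !mxE !eqxx/= mulr1.
rewrite (eq_bigr (fun i => x ord0 i ^+ 2)); first by ring.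
by move=> i ij; rewrite !mxE (negbTE ij) mulr0 add0r.
Qed.

Lemma enorm_eq0 x : enorm x = 0 -> x = 0.
Proof.
move=> x0; apply/rowP => j; rewrite mxE; apply/eqP; rewrite -normr_le0.
by rewrite -x0 coord_le_enorm.
Qed.

Lemma enorm00 : enorm (0 : V) = 0.
Proof. by rewrite /enorm big1 ?sqrtr0// => i _; rewrite mxE expr0n. Qed.

Lemma enorm_delta (r : R) (j : 'I_n) : 0 <= r -> enorm (r *: delta_mx ord0 j : V) = r.
Proof.
move=> r0; have := enorm_line 0 j r; rewrite addr0 => ->.
by rewrite enorm00 mxE mulr0 expr0n/= addr0 add0r sqrtr_sqr ger0_norm.
Qed.

Lemma is_derive_enorm_line x (j : 'I_n) : x != 0 ->
  is_derive (0 : R) 1 (fun h : R => enorm (h *: delta_mx ord0 j + x))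
    (x ord0 j / enorm x).
Proof.
move=> x0; have e0 : 0 < enorm x.
  by rewrite lt_neqAle enorm_ge0 andbT eq_sym; apply: contra_neq x0 => /enorm_eq0.
under eq_fun do rewrite enorm_line.
have d1 : is_derive (0 : R) 1 (fun h : R => enorm x ^+ 2 + 2 * h * x ord0 j + h ^+ 2)
    (2 * x ord0 j).
  have dl := is_derive1_mul (is_derive1_mul (is_derive_cst (2 : R) (0 : R) (1 : R))
    (is_derive_id (0 : R) (1 : R))) (is_derive_cst (x ord0 j) (0 : R) (1 : R)).
  have dc := is_derive_cst (enorm x ^+ 2) (0 : R) (1 : R).
  apply: (is_derive_eq (is_deriveD (is_deriveD dc dl) (is_derive1_exp 2 (0 : R)))).
  by rewrite /cst /=; ring.
have d2 : is_derive (enorm x ^+ 2) 1 Num.sqrt (2 * enorm x)^-1.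
  apply: (is_derive_eq (is_derive1_sqrt _)); first by rewrite exprn_gt0.
  by rewrite sqrtr_sqr gtr0_norm.
have g0 : enorm x ^+ 2 + 2 * 0 * x ord0 j + 0 ^+ 2 = enorm x ^+ 2 :> R by ring.
apply: (is_derive_eq (is_derive1_chain d1 g0 d2)).
by field; rewrite gt_eqF.
Qed.

Lemma is_derive_along (u : V -> R) (j : 'I_n) x (l : R) :
  is_derive (0 : R) 1 (fun h : R => u (h *: delta_mx ord0 j + x)) l ->
  is_derive x (delta_mx ord0 j) u l.
Proof.
by apply: is_derive_line => h; rewrite addr0 [h *: 1]mulr1.
Qed.

Lemma enorm0_line (j : 'I_n) (h : R) : enorm (h *: delta_mx ord0 j + 0 : V) = `|h|.
Proof.
by rewrite enorm_line enorm00 mxE mulr0 expr0n/= addr0 add0r sqrtr_sqr.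
Qed.

Variables (W p G : R -> R) (m : R).
Hypothesis cp : continuous p.
Hypothesis cG : continuous G.
Hypothesis G0 : m * p 0 = G 0.
Hypothesis dW : forall r : R, 0 <= r -> is_derive r 1 W (r * p r).
Hypothesis dp : forall r : R, 0 < r -> is_derive r 1 p ((G r - m * p r) / r).

Definition radial x := W (enorm x).
Definition radial_grad (i : 'I_n) x := p (enorm x) * x ord0 i.
(** In the classical formula for the Hessian, [r p'] is replaced by [G - m p], which tends to 0 at
    the origin. There the quotient by zero is 0 and [p 0] times the identity remains. *)
Definition radial_hess (i j : 'I_n) x :=
  p (enorm x) * (i == j)%:R +
  (G (enorm x) - m * p (enorm x)) * (x ord0 i * x ord0 j / enorm x ^+ 2).

Lemma continuous_radial : continuous radial.
Proof.
move=> x; apply: continuous_comp; first exact: continuous_enorm.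
exact: is_derive1_continuous (dW (enorm_ge0 x)).
Qed.

Lemma continuous_comp_enorm (g : R -> R) : continuous g ->
  continuous (fun x : V => g (enorm x)).
Proof.
by move=> cg x; apply: continuous_comp; [exact: continuous_enorm|exact: cg].
Qed.

Lemma continuous_radial_grad i : continuous (radial_grad i).
Proof.
apply: continuous_mul; first exact: continuous_comp_enorm.
exact: coord_continuous.
Qed.

Let q r := G r - m * p r.
Let cq : continuous q.
Proof.
by move=> r; apply: cvgB; [exact: cG|apply: cvgM; [exact: cvg_cst|exact: cp]].
Qed.
Let q0 : q 0 = 0. Proof. by rewrite /q G0 subrr. Qed.

Lemma continuous_radial_hess i j : continuous (radial_hess i j).
Proof.
apply: continuous_add.
  by apply: continuous_mul; [exact: continuous_comp_enorm|exact: cst_continuous].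
move=> x; have [->|x0] := eqVneq x 0; last first.
  have e0 : enorm x != 0 by apply: contra_neq x0 => /enorm_eq0.
  apply: (@continuous_at_quotient _ _ (fun y : V => q (enorm y)) (fun y : V => y ord0 i)
    (fun y : V => y ord0 j) (@enorm R n) x); [exact: (continuous_comp_enorm cq)|
    exact: coord_continuous|exact: coord_continuous|exact: continuous_enorm|by rewrite expf_neq0].
have bnd y : `|q (enorm y) * (y ord0 i * y ord0 j / enorm y ^+ 2)| <= `|q (enorm y)|.
  have [->|y0] := eqVneq y 0; first by rewrite enorm00 expr0n/= invr0 !mulr0 normr0.
  have e0 : 0 < enorm y.
    by rewrite lt_neqAle enorm_ge0 andbT eq_sym; apply: contra_neq y0 => /enorm_eq0.
  rewrite normrM ler_piMr// normrM normfV normrX (gtr0_norm e0).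
  by rewrite ler_pdivrMr ?exprn_gt0// mul1r expr2 normrM ler_pM// coord_le_enorm.
apply: (continuous_at_dominated bnd).
- exact: continuous_comp_enorm.
- by rewrite enorm00 expr0n/= invr0 !mulr0.
- by rewrite enorm00 q0.
Qed.

Lemma is_derive_radial i x : is_derive x (delta_mx ord0 i) radial (radial_grad i x).
Proof.
apply: is_derive_along; have [->|x0] := eqVneq x 0; last first.
  have e0 : enorm x != 0 by apply: contra_neq x0 => /enorm_eq0.
  have d1 := is_derive_enorm_line i x0.
  have g0 : enorm (0 *: delta_mx ord0 i + x) = enorm x by rewrite scale0r add0r.
  apply: (is_derive_eq (is_derive1_chain d1 g0 (dW (enorm_ge0 x)))).
  by rewrite /radial_grad; field.
rewrite /radial_grad mxE mulr0 /radial.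
under eq_fun do rewrite enorm0_line.
(* On a line through the origin the function is [W |z|]. As [W' 0 = 0], the difference quotient
   [g |z|] times the sign of [z] still tends to 0. *)
have := dW (lexx 0); rewrite mul0r => /is_derive1_caratheodory[g [Wg cg g0]].
apply/is_derive1_caratheodory; exists (fun z => g `|z| * Num.sg z); split.
- by move=> z; rewrite normr0 Wg !subr0 -mulrA -normrEsg.
- apply/cvgrPdist_le => e e0; rewrite sgr0 mulr0.
  have cg' : {for 0, continuous (g \o (fun z : R => `|z|))}.
    by apply: continuous_comp; [exact: norm_continuous|rewrite normr0].
  have /cvgrPdist_le /(_ e e0) := cg'; rewrite /= normr0 g0.
  apply: filterS => z; rewrite !sub0r !normrN => H; rewrite normrM normr_sg.
  by apply: le_trans H; rewrite ler_piMr// lern1 leq_b1.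
- by rewrite normr0 sgr0 mulr0.
Qed.

Lemma is_derive_radial_grad i j x :
  is_derive x (delta_mx ord0 j) (radial_grad i) (radial_hess i j x).
Proof.
apply: is_derive_along.
have coordE h y : (h *: delta_mx ord0 j + y) ord0 i = h * (i == j)%:R + y ord0 i :> R.
  by rewrite !mxE eqxx.
have [->|x0] := eqVneq x 0; last first.
  have e0 : 0 < enorm x.
    by rewrite lt_neqAle enorm_ge0 andbT eq_sym; apply: contra_neq x0 => /enorm_eq0.
  have d1 := is_derive_enorm_line j x0.
  have g0 : enorm (0 *: delta_mx ord0 j + x) = enorm x by rewrite scale0r add0r.
  have d3 : is_derive (0 : R) 1 (fun h : R => h * (i == j)%:R + x ord0 i) ((i == j)%:R : R).
    have dl := is_derive1_mul (is_derive_id (0 : R) (1 : R))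
      (is_derive_cst ((i == j)%:R : R) (0 : R) (1 : R)).
    apply: (is_derive_eq (is_deriveD dl (is_derive_cst (x ord0 i) (0 : R) (1 : R)))).
    by rewrite /cst /= mul0r !addr0 mul1r.
  rewrite /radial_grad; under eq_fun do rewrite coordE.
  apply: (is_derive_eq (is_derive1_mul (is_derive1_chain d1 g0 (dp e0)) d3)).
  rewrite /radial_hess scale0r mul0r !add0r.
  by field; rewrite gt_eqF.
rewrite /radial_grad /radial_hess enorm00 -/(q 0) q0 mul0r addr0.
(* On a line through the origin the difference quotient is explicit, and only the continuity of [p]
   is needed. *)
apply/is_derive1_caratheodory; exists (fun z => p `|z| * (i == j)%:R); split.
- move=> z; rewrite !coordE !enorm0_line mxE !addr0 mul0r mulr0 !subr0.
  by rewrite mulrAC mulrA.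
- apply: cvgM; last exact: cvg_cst.
  by apply: (@continuous_comp _ _ _ (fun z : R => `|z|) p); [exact: norm_continuous|exact: cp].
- by rewrite normr0.
Qed.

Lemma radial_H2 : H2 unit_ball radial radial_grad radial_hess.
Proof.
split.
  apply: classical_H1; [exact: continuous_radial|exact: continuous_radial_grad|].
  by move=> i x; exact: is_derive_radial.
move=> i; apply: classical_H1; [exact: continuous_radial_grad|
  exact: continuous_radial_hess|].
by move=> j x; exact: is_derive_radial_grad.
Qed.

Lemma radial_trace i : trace (radial_grad i) (radial_hess i) (radial_grad i).
Proof.
by apply: classical_trace; [exact: continuous_radial_grad|exact: (radial_H2.2 i)].
Qed.

Lemma radial_euler x : \sum_i x ord0 i * radial_grad i x = enorm x ^+ 2 * p (enorm x).
Proof.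
rewrite sqr_enorm mulr_suml; apply: eq_bigr => i _.
by rewrite /radial_grad mulrCA mulrC expr2.
Qed.

Lemma radial_laplacian x : m = n%:R -> \sum_i radial_hess i i x = G (enorm x).
Proof.
move=> mn; rewrite /radial_hess big_split/= -!mulr_sumr.
under eq_bigr do rewrite eqxx.
rewrite sumr_const card_ord -mulr_suml -[X in _ + _ * (X * _)]sqr_enorm -mn.
have [->|x0] := eqVneq x 0.
  by rewrite enorm00 -/(q 0) q0 mul0r addr0 mulrC.
have e0 : enorm x != 0 by apply: contra_neq x0 => /enorm_eq0.
by rewrite divff ?expf_neq0// mulr1 mulrC addrC subrK.
Qed.

End radial_functions.

(** * Nonconstancy and conclusion *)

Lemma ae_unit_ball_eq (R : realType) (n : nat) (u : 'rV[R]_n -> R) (c : R) :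
  continuous u ->
  {ae (lebesgue_rV n : {measure set 'rV[R]_n -> \bar R}),
    forall x, unit_ball x -> u x = c} ->
  forall x, unit_ball x -> u x = c.
Proof.
move=> cu [A [mA A0 subA]] x Bx; apply: contrapT => uxc.
pose U : set 'rV[R]_n := (@enorm R n) @^-1` [set r | r < 1] `&` u @^-1` [set r | r != c].
have oU : open U.
  apply: openI; apply: open_comp.
  - by move=> y _; exact: continuous_enorm.
  - exact: open_lt.
  - by move=> y _; exact: cu.
  - exact: open_neq.
have /nbhs_ballP[e /= e0 xeU] : nbhs x U.
  by apply: open_nbhs_nbhs; split => //; split => //; exact/eqP.
(* A ball on which [u] differs from [c] would have positive measure inside a null set. *)
have sub : ball x e `<=` A.
  by move=> y /xeU[By uyc]; apply: subA => /(_ By) /eqP; rewrite (negbTE uyc).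
have : (lebesgue_rV n (ball x e) <= 0)%E.
  by rewrite -A0; apply: le_measure; rewrite ?inE//; exact: measurable_rV_ball.
by rewrite lebesgue_rV_ball// -EFin_expe lee_fin leNgt exprn_gt0// mulrn_wgt0.
Qed.

(** Differentiate twice: [W' = r p] vanishes, hence so do [p], [p'] and then [G] for [0 < r < 1].
    The centre follows from the continuity of [p] and [m * p 0 = G 0]. *)
Lemma slope_eq0 (R : realType) (W p G : R -> R) (m c : R) :
  continuous p -> m * p 0 = G 0 ->
  (forall r : R, 0 <= r -> is_derive r 1 W (r * p r)) ->
  (forall r : R, 0 < r -> is_derive r 1 p ((G r - m * p r) / r)) ->
  (forall r : R, 0 <= r < 1 -> W r = c) ->
  forall r : R, 0 <= r < 1 -> p r = 0 /\ G r = 0.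
Proof.
move=> cp G0 dW dp Wc.
have near_oo (r : R) (P : R -> Prop) : (forall s : R, 0 < s < 1 -> P s) -> 0 < r < 1 ->
    \forall s \near r, P s.
  move=> HP /andP[r0 r1]; near=> s; apply: HP; apply/andP; split; near: s.
    exact: lt_nbhsr.
  exact: lt_nbhsl.
have p0 (r : R) : 0 < r < 1 -> p r = 0.
  move=> r01; have /andP[r0 r1] := r01.
  have dc : is_derive r 1 W 0.
    apply: (near_eq_is_derive _ (is_derive_cst c r (1 : R))).
    by apply: near_oo r01 => s /andP[s0 s1]; rewrite Wc// ltW.
  have [_] := dW r (ltW r0); have [_ ->] := dc => /esym/eqP.
  by rewrite mulf_eq0 gt_eqF//= => /eqP.
have pG (r : R) : 0 < r < 1 -> G r = 0.
  move=> r01; have /andP[r0 r1] := r01.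
  have dc : is_derive r 1 p 0.
    apply: (near_eq_is_derive _ (is_derive_cst (0 : R) r (1 : R))).
    by apply: near_oo r01 => s s01; rewrite p0.
  have [_] := dp r r0; have [_ ->] := dc => /esym/eqP.
  by rewrite p0// mulr0 subr0 mulf_eq0 invr_eq0 [r == 0]gt_eqF// orbF => /eqP.
have p00 : p 0 = 0.
  apply/eqP; apply/negP => /negP pn0.
  have := @cp 0 => /cvgr_neq0 /(_ pn0) [e /= e0 He].
  pose r := Num.min (e / 2) (1 / 2).
  have r0 : 0 < r by rewrite lt_min !divr_gt0.
  have r1 : r < 1 by rewrite gt_min [X in _ || X]ltr_pdivrMr// mul1r ltr1n orbT.
  have re : r < e by rewrite gt_min ltr_pdivrMr// ltr_pMr// ltr1n.
  have := He r; rewrite /= sub0r normrN gtr0_norm// => /(_ re).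
  by rewrite p0 ?eqxx// r0.
move=> r /andP[]; rewrite le_eqVlt => /predU1P[<- _|r0 r1].
  by rewrite -G0 p00 mulr0.
by rewrite p0 ?pG ?r0.
Unshelve. all: by end_near. Qed.

Theorem theorem1p2 (R : realType) (N : nat) (a b f : R -> R)
  (N_ge2 : (2 <= N)%N)
  (a_C1 : C1_on `[0, 1] a)
  (a_homo : {in `[0, 1] &, {homo a : r s / r <= s}})
  (a0_gt0 : 0 < a 0)
  (a_nonconst : exists x y : 'rV[R]_N,
     [/\ unit_ball x, unit_ball y & a (enorm x) <> a (enorm y)])
  (b_cont : {within `[0, 1], continuous b})
  (b_le0 : forall r, r \in `[0, 1] -> b r <= 0)
  (br_derivable : forall r, r \in `]0, 1[ ->
     derivable (fun s : R => b s * s) r 1)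
  (br_deriv : forall r, r \in `]0, 1[ ->
     -1 - (N%:R - 1) / r ^+ 2 < derive1 (fun s : R => b s * s) r)
  (f_C1 : C1_on `[0, +oo[ f)
  (f_homo : {in `[0, +oo[ &, {homo f : s t / s <= t}})
  (f_0 : f 0 = 0)
  (f_deriv0 : f s / s @[s --> 0^'+] --> 0)
  (f_liminf : ((a 0)^-1%:E < limf_einf (fun s => (f s / s)%:E) (pinfty_nbhs R))%E) :
  exists u : 'rV[R]_N -> R,
    [/\ solution a b f u, ae_nonconstant u & radial_nondecreasing u].
Proof.
case: N N_ge2 a_nonconst br_deriv => [//|n] _ a_nonconst _.
have [d [W [p [G [d0 cp cG p1 [G0 dW dp WpG]]]]]] := @radial_profile R n a b f
  a_C1 a_homo a0_gt0 b_cont b_le0 f_C1 f_homo f_0 f_deriv0 f_liminf.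
have e01 (x : 'rV[R]_n.+1) : unit_ball x -> 0 <= enorm x <= 1.
  by move=> /ltW x1; rewrite enorm_ge0.
exists (radial W); split.
- exists (radial_grad p), (radial_hess p G n.+1%:R); split.
  + exact: radial_H2.
  + apply: aeW => x Bx; have [_ _ GE] := WpG _ (e01 x Bx).
    rewrite (radial_laplacian G0)// radial_euler GE /radial; ring.
  + by move=> x Bx; have [_ dWx _] := WpG _ (e01 x Bx); exact: lt_le_trans dWx.
  + exists (radial_grad p); split; first by move=> i; exact: (radial_trace cp cG G0 dW dp).
    apply: aeW => x Sx; under eq_bigr do rewrite mulrC.
    by rewrite radial_euler Sx p1 mulr0.
- move=> [c uc].
  have {}uc := ae_unit_ball_eq (continuous_radial dW) uc.
  have Wc (r : R) : 0 <= r < 1 -> W r = c.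
    move=> /andP[r0 r1]; have := uc (r *: delta_mx ord0 ord0).
    by rewrite /radial /unit_ball/= enorm_delta//; exact.
  (* For a constant profile the equation reduces to this identity. As [c >= d > 0], [f c] is nonzero
     and can be cancelled, so [a] would be constant. *)
  have ac (x : 'rV[R]_n.+1) : unit_ball x -> c = a (enorm x) * f c.
    move=> Bx; have x01 : 0 <= enorm x < 1 by rewrite enorm_ge0.
    have [px Gx] := slope_eq0 cp G0 dW dp Wc x01.
    have [_ _] := WpG _ (e01 x Bx); rewrite Gx px mulr0 addr0 Wc// => /esym/eqP.
    by rewrite subr_eq0 => /eqP.
  have c0 : 0 < c.
    have [|_ + _] := WpG 0; first by rewrite lexx ler01.
    by rewrite Wc ?lexx ?ltr01//; exact: lt_le_trans.
  have fc : f c != 0.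
    apply/eqP => fc0; have [x [y [Bx _ _]]] := a_nonconst.
    by have := c0; rewrite (ac x Bx) fc0 mulr0 ltxx.
  have [x [y [Bx By]]] := a_nonconst; apply.
  by apply: (mulIf fc); rewrite -(ac x Bx) -(ac y By).
- exists W; split=> // r s; rewrite !in_itv/= => /andP[r0 r1] /andP[s0 s1] rs.
  rewrite -lerN2; apply: (@derivative_le0_le _ (- W) (fun t => - (t * p t)) r s rs).
  + move=> t /andP[rt ts]; have t0 : 0 <= t by rewrite ltW// (le_lt_trans r0).
    by have := dW t t0 => dWt; exact: is_deriveN.
  + move=> t /andP[rt _]; apply: continuousN.
    exact: is_derive1_continuous (dW t (le_trans r0 rt)).
  + move=> t /andP[rt ts]; have t0 : 0 <= t by rewrite ltW// (le_lt_trans r0).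
    have t01 : 0 <= t <= 1 by rewrite t0 ltW// (lt_trans ts).
    have [pt _ _] := WpG t t01.
    by rewrite oppr_le0 mulr_ge0.
Qed.
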